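(* Let $R$ be a ring, $\mathcal{GP}(R)$ the Frobenius exact category of Gorenstein projective left $R$-modules, $\mathcal{P}(R)$ the class of projective left $R$-modules, and $\underline{\mathcal{GP}(R)}$ the stable category of $\mathcal{GP}(R)$. The assignments $$\underline{\mathcal{M}}\mapsto \mathcal{M}^{\perp}\qquad\text{and}\qquad \mathcal{H}\mapsto \underline{\mathcal{H}\cap{}^{\perp}\mathcal{H}}$$ give mutually inverse bijections between the following classes: (1) Silting subcategories $\underline{\mathcal{M}}$ of $\underline{\mathcal{GP}(R)}$ with $\mathcal{P}(R)\subseteq\mathcal{M}$. (2) Subcategories $\mathcal{H}$ of $\mathcal{GP}(R)$ which are specially covariantly finite and coresolving in $\mathcal{GP}(R)$, such that $\check{\mathcal{H}}=\mathcal{GP}(R)$ and such that for any $H\in\mathcal{H}$ there exists a positive integer $t\geq1$ with $\mathrm{Ext}^{i}_{R}(H,\mathcal{H})=0$ for all $i\geq t$.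
   Context: A left $R$-module $N$ is Gorenstein projective if there is an exact sequence $\mathbf{P}=\cdots\to P_1\to P_0\to P_{-1}\to P_{-2}\to\cdots$ of projective left $R$-modules with $N\cong\mathrm{Ker}(P_{-1}\to P_{-2})$ such that $\mathrm{Hom}_R(\mathbf{P},Q)$ is exact for every projective left $R$-module $Q$. $\mathcal{GP}(R)$, with conflations the short exact sequences of modules with all terms in $\mathcal{GP}(R)$, is a Frobenius exact category whose projective (= injective) objects are the projective modules. ''Subcategory'' always means full additive subcategory closed under isomorphisms and direct summands. The stable category $\underline{\mathcal{GP}(R)}$ has morphisms modulo those factoring through projective modules, with its usual triangulated structure (shift $A[1]$ given by a conflation $A\to P\to A[1]$ with $P$ projective). For a subcategory $\mathcal{M}\supseteq\mathcal{P}(R)$ of $\mathcal{GP}(R)$, $\underline{\mathcal{M}}$ is the full subcategory of $\underline{\mathcal{GP}(R)}$ on the objects of $\mathcal{M}$. Orthogonals are formed inside $\mathcal{GP}(R)$: $\mathcal{X}^{\perp}=\{Y\in\mathcal{GP}(R)\mid\mathrm{Ext}^{i}_R(X,Y)=0\ \forall i\ge1,\forall X\in\mathcal{X}\}$, ${}^{\perp}\mathcal{X}=\{Y\in\mathcal{GP}(R)\mid\mathrm{Ext}^{i}_R(Y,X)=0\ \forall i\ge1,\forall X\in\mathcal{X}\}$. $\mathrm{Ext}^{i}_R(H,\mathcal{H})=0$ means $\mathrm{Ext}^{i}_R(H,H')=0$ for all $H'\in\mathcal{H}$. $\mathcal{H}$ is coresolving in $\mathcal{GP}(R)$ if it contains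 $\mathcal{P}(R)$ and is closed under extensions and cones of inflations (for a conflation $A\to B\to C$ in $\mathcal{GP}(R)$: $A,C\in\mathcal{H}$ implies $B\in\mathcal{H}$; $A,B\in\mathcal{H}$ implies $C\in\mathcal{H}$). $\mathcal{H}$ is specially covariantly finite in $\mathcal{GP}(R)$ if for every $C\in\mathcal{GP}(R)$ there is a conflation $C\to H\to K$ in $\mathcal{GP}(R)$ with $H\in\mathcal{H}$ and $\mathrm{Ext}^1_R(K,\mathcal{H})=0$. $\check{\mathcal{H}}$ is the class of $C\in\mathcal{GP}(R)$ such that for some $n\ge0$ there are conflations $K_i\to H_{-i}\to K_{i+1}$ in $\mathcal{GP}(R)$ ($0\le i\le n-1$) with $K_0=C$, $K_n=H_{-n}$ and all $H_{-i}\in\mathcal{H}$, $0\le i\le n$ (for $n=0$: $C\cong H_0$). A subcategory $\mathcal{N}$ of a triangulated category $\mathcal{T}$ is silting if $\mathrm{Hom}_{\mathcal{T}}(\mathcal{N},\mathcal{N}[i])=0$ for all $i>0$ and $\mathcal{T}$ is the smallest triangulated subcategory of $\mathcal{T}$ containing $\mathcal{N}$ and closed under direct summands and isomorphisms. *)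

(* Defs.v *)
From mathcomp Require Import all_boot all_order all_algebra.

Set Implicit Arguments.
Unset Strict Implicit.
Unset Printing Implicit Defensive.

Import GRing.Theory.
Local Open Scope ring_scope.

(* Full subcategories, closed under isomorphism, are given by the predicate
   [lmodType R -> Prop] on their objects. *)

Section Modules.
Variable R : pzRingType.
Implicit Types (A B C X Y Z P Q : lmodType R) (H S : lmodType R -> Prop).

Definition surj A B (f : {linear A -> B}) : Prop := forall y, exists x, f x = y.

Definition exact_at A B C (f : {linear A -> B}) (g : {linear B -> C}) : Prop :=
  forall y, g y = 0 <-> exists x, f x = y.

Definition short_exact A B C (f : {linear A -> B}) (g : {linear B -> C}) : Prop :=
  [/\ injective f, exact_at f g & surj g].

Definition mod_iso A B : Prop :=
  exists (f : {linear A -> B}) (g : {linear B -> A}), cancel f g /\ cancel g f.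

Definition projective P : Prop :=
  forall A B (g : {linear A -> B}) (f : {linear P -> B}), surj g ->
  exists h : {linear P -> A}, forall x, g (h x) = f x.

(* The differential leaving degree [n + 1] is [d n]; exactness in every degree
   is stated at [n + 1] because [n - 1 + 1] is not convertible to [n]. *)
Definition acyclic (P : int -> lmodType R)
    (d : forall n, {linear P (n + 1) -> P n}) : Prop :=
  forall n, exact_at (d (n + 1)) (d n).

Definition Hom_acyclic (P : int -> lmodType R)
    (d : forall n, {linear P (n + 1) -> P n}) Q : Prop :=
  forall n (g : {linear P (n + 1) -> Q}),
    (forall x, g (d (n + 1) x) = 0) <->
    exists h : {linear P n -> Q}, forall x, h (d n x) = g x.

(* [k] identifies [N] with Ker(P_{-1} -> P_{-2}); [-2 + 1] computes to [-1]. *)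
Definition gorenstein_projective (N : lmodType R) : Prop :=
  exists (P : int -> lmodType R) (d : forall n, {linear P (n + 1) -> P n}),
  [/\ forall n, projective (P n),
      acyclic d,
      forall Q, projective Q -> Hom_acyclic d Q
    & exists k : {linear N -> P (- 2 + 1)},
        injective k /\ exact_at k (d (- 2))].

Definition conflation A B C (f : {linear A -> B}) (g : {linear B -> C}) : Prop :=
  [/\ gorenstein_projective A, gorenstein_projective B,
      gorenstein_projective C & short_exact f g].

Definition proj_resolution X (P : nat -> lmodType R)
    (d : forall n, {linear P n.+1 -> P n}) (e : {linear P 0 -> X}) : Prop :=
  [/\ forall n, projective (P n), surj e, exact_at (d 0) e
    & forall n, exact_at (d n.+1) (d n)].

Definition cocycle (P : nat -> lmodType R) (d : forall n, {linear P n.+1 -> P n})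
    Y i (f : {linear P i -> Y}) : Prop :=
  forall x, f (d i x) = 0.

Definition coboundary (P : nat -> lmodType R)
    (d : forall n, {linear P n.+1 -> P n}) Y i : {linear P i -> Y} -> Prop :=
  match i with
  | 0 => fun f => forall x, f x = 0
  | j.+1 => fun f => exists h : {linear P j -> Y}, forall x, f x = h (d j x)
  end.

(* Ext^i_R(X, Y) = 0, where Ext^i_R(X, Y) is the i-th cohomology of Hom_R(P, Y);
   this does not depend on the projective resolution P of X, and if X is
   Gorenstein projective the definition provides such a resolution. *)
Definition Ext_zero i X Y : Prop :=
  forall (P : nat -> lmodType R) (d : forall n, {linear P n.+1 -> P n})
    (e : {linear P 0 -> X}), proj_resolution d e ->
  forall f : {linear P i -> Y}, cocycle d f -> coboundary d f.

Definition right_perp H Y : Prop :=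
  gorenstein_projective Y /\
  forall i, (1 <= i)%N -> forall X, H X -> Ext_zero i X Y.

Definition left_perp H Y : Prop :=
  gorenstein_projective Y /\
  forall i, (1 <= i)%N -> forall X, H X -> Ext_zero i Y X.

(* Full additive subcategories of a category whose objects are the Gorenstein
   projective modules, whose biproducts are the direct sums of modules, and
   whose isomorphism relation is [iso]; used for GP(R) and for its stable
   category. *)
Definition additive_subcat (iso : lmodType R -> lmodType R -> Prop) H : Prop :=
  [/\ forall X, H X -> gorenstein_projective X,
      exists2 Z, H Z & forall z : Z, z = 0,
      forall X Y, H X -> H Y -> H (X * Y)%type
    & forall X Y, gorenstein_projective Y -> iso X Y -> H X -> H Y].

Definition summand_closed (iso : lmodType R -> lmodType R -> Prop) H : Prop :=
  forall X Y Z, gorenstein_projective X -> gorenstein_projective Z ->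
  iso (X * Z)%type Y -> H Y -> H X.

Definition subcategory iso H : Prop :=
  additive_subcat iso H /\ summand_closed iso H.

Definition coresolving H : Prop :=
  [/\ forall P, projective P -> H P,
      forall A B C (f : {linear A -> B}) (g : {linear B -> C}),
        conflation f g -> H A -> H C -> H B
    & forall A B C (f : {linear A -> B}) (g : {linear B -> C}),
        conflation f g -> H A -> H B -> H C].

Definition specially_covariantly_finite H : Prop :=
  forall C, gorenstein_projective C ->
  exists (X K : lmodType R) (f : {linear C -> X}) (g : {linear X -> K}),
  [/\ conflation f g, H X & forall Y, H Y -> Ext_zero 1 K Y].

(* The class written H with a check accent; [L i] stands for H_{-i}. *)
Definition check_class H C : Prop :=
  gorenstein_projective C /\
  exists (n : nat) (K L : nat -> lmodType R),
  [/\ mod_iso (K 0%N) C, mod_iso (K n) (L n),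
      forall i, (i <= n)%N -> H (L i)
    & forall i, (i < n)%N ->
        exists (f : {linear K i -> L i}) (g : {linear L i -> K i.+1}),
        conflation f g].

(* The stable category: its objects are the Gorenstein projective modules, and
   linear maps represent its morphisms up to [stable_eq]. *)
Definition stably_zero A B (f : A -> B) : Prop :=
  exists Q, projective Q /\
  exists (a : {linear A -> Q}) (b : {linear Q -> B}), forall x, f x = b (a x).

Definition stable_eq A B (f g : A -> B) : Prop :=
  stably_zero (fun x => f x - g x).

Definition stable_inverse A B (f : {linear A -> B}) (g : {linear B -> A}) : Prop :=
  stable_eq (g \o f) idfun /\ stable_eq (f \o g) idfun.

Definition is_stable_iso A B (f : {linear A -> B}) : Prop :=
  exists g : {linear B -> A}, stable_inverse f g.

Definition stable_iso A B : Prop :=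
  exists f : {linear A -> B}, is_stable_iso f.

(* [B] is A[1]. The shift of an object is only determined up to stable
   isomorphism, so it is treated as a relation. *)
Definition shift A B : Prop :=
  exists (P : lmodType R) (a : {linear A -> P}) (b : {linear P -> B}),
  projective P /\ conflation a b.

(* [B] is A[i]. *)
Fixpoint shiftn i A B : Prop :=
  match i with
  | 0 => A = B
  | j.+1 => exists2 C, shift A C & shiftn j C B
  end.

(* A triangle X -> Y -> Z -> X[1], together with the conflation X -> P -> X[1]
   presenting the shift of X. *)
Record triangle := Triangle {
  tX : lmodType R; tY : lmodType R; tZ : lmodType R; tX1 : lmodType R;
  tP : lmodType R;
  tu : {linear tX -> tY};
  tv : {linear tY -> tZ};
  tw : {linear tZ -> tX1};
  ta : {linear tX -> tP};
  tb : {linear tP -> tX1};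
  tP_proj : projective tP;
  tY_gp : gorenstein_projective tY;
  tZ_gp : gorenstein_projective tZ;
  tab_conf : conflation ta tb
}.

(* Pushout of X -> P -> X[1] along u : X -> Y, giving Y -> Z -> X[1]. *)
Definition standard_triangle (t : triangle) : Prop :=
  conflation (tv t) (tw t) /\
  exists p : {linear tP t -> tZ t},
    (forall x, p (ta t x) = tv t (tu t x)) /\ (forall x, tw t (p x) = tb t x).

(* The map [q] between the middle terms witnesses that [f1] represents f[1]. *)
Definition shift_map (t t' : triangle) (f : {linear tX t -> tX t'})
    (f1 : {linear tX1 t -> tX1 t'}) : Prop :=
  exists q : {linear tP t -> tP t'},
    (forall x, q (ta t x) = ta t' (f x)) /\ (forall x, tb t' (q x) = f1 (tb t x)).

Definition triangle_iso (t t' : triangle) : Prop :=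
  exists (f : {linear tX t -> tX t'}) (g : {linear tY t -> tY t'})
    (h : {linear tZ t -> tZ t'}) (f1 : {linear tX1 t -> tX1 t'}),
  [/\ is_stable_iso f, is_stable_iso g, is_stable_iso h & shift_map f f1] /\
  [/\ stable_eq (g \o tu t) (tu t' \o f),
      stable_eq (h \o tv t) (tv t' \o g)
    & stable_eq (f1 \o tw t) (tw t' \o h)].

Definition distinguished (t : triangle) : Prop :=
  exists2 t', standard_triangle t' & triangle_iso t' t.

Definition triangulated_subcat S : Prop :=
  [/\ additive_subcat stable_iso S,
      forall A B, shift A B -> (S A <-> S B)
    & forall t, distinguished t -> S (tX t) -> S (tY t) -> S (tZ t)].

Definition thick_subcat S : Prop :=
  triangulated_subcat S /\ summand_closed stable_iso S.

Definition thick_closure S X : Prop :=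
  gorenstein_projective X /\
  forall S', thick_subcat S' -> (forall Y, S Y -> S' Y) -> S' X.

(* Silting subcategories of the stable category. *)
Definition silting S : Prop :=
  [/\ subcategory stable_iso S,
      forall X Y Y' i, (0 < i)%N -> S X -> S Y -> shiftn i Y Y' ->
        forall f : {linear X -> Y'}, stably_zero f
    & forall X, thick_closure S X <-> gorenstein_projective X].

Definition silting_class (M : lmodType R -> Prop) : Prop :=
  [/\ subcategory mod_iso M, forall P, projective P -> M P & silting M].

Definition coresolving_class H : Prop :=
  [/\ subcategory mod_iso H,
      specially_covariantly_finite H,
      coresolving H,
      forall C, check_class H C <-> gorenstein_projective C
    & forall X, H X -> exists2 t : nat, (1 <= t)%N &
        forall i, (t <= i)%N -> forall Y, H Y -> Ext_zero i X Y].

Definition coheart H X : Prop := H X /\ left_perp H X.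

End Modules.

(* Main.v *)
(* In the Frobenius category GP(R), Ext^(i+1)(X, Y) vanishes iff Ext^1(X, Y[i])
   does, iff Ext^1(X[-i], Y) does, so every orthogonality condition is a
   condition on Ext^1 and on the shifts. A class of objects containing the
   projectives, closed under extensions and under cancelling projective
   summands, pulls back along the shift in both directions to a class of the
   same kind, and is compatible with rotating triangles.

   Silting to coresolving: let H be the right orthogonal of M and let K range
   over the iterated extensions of the M[-n], n >= 0. The objects all of whose
   shifts admit a conflation C -> X -> K with X in H, and which have some
   positive shift in H, form a thick class containing M, hence are all objects.
   For summands: if C + Z and Z[1] have such a conflation then so has C, and
   C[n], Z[n] lie in H for large n. Each K embeds in an object of M with
   cokernel left orthogonal to H, so an X in H that is left orthogonal to H is a
   summand of an object of M.

   Coresolving to silting: if X in H has Ext^i(X, H) = 0 for i > t, approximating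
   X[-1] gives a conflation Y -> E -> X with E in the coheart, Y in H and the
   bound for Y lowered by one; thus the coheart generates H, and then everything
   since the check class of H is everything. *)

Require Import Defs.
From mathcomp Require Import all_boot all_order all_algebra.
From HB Require Import structures.
From mathcomp Require Import generic_quotient ring_quotient boolp.

Set Implicit Arguments.
Unset Strict Implicit.
Unset Printing Implicit Defensive.

Import GRing.Theory.
Local Open Scope ring_scope.
Local Open Scope quotient_scope.

(** * Kernels and cokernels *)

Section LinearMaps.
Variable R : pzRingType.
Implicit Types (A B C X Y Z : lmodType R).

Definition lin A B (f : A -> B) (lf : linear f) : {linear A -> B} :=
  HB.pack f (GRing.isLinear.Build R A B *:%R f lf).

Section Kernel.
Variables (A B : lmodType R) (f : {linear A -> B}).

Definition ker_pred : {pred A} := [pred x | f x == 0].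

Fact ker_submod : submod_closed ker_pred.
Proof.
split=> [|a u v]; rewrite !inE ?raddf0 //.
by move=> /eqP fu /eqP fv; rewrite linearP fu fv scaler0 addr0.
Qed.

HB.instance Definition _ := GRing.isSubmodClosed.Build R A ker_pred ker_submod.

Record kernel := Kernel { kernel_val : A; _ : kernel_val \in ker_pred }.
HB.instance Definition _ := [isSub for kernel_val].
HB.instance Definition _ := [Choice of kernel by <:].
HB.instance Definition _ := [SubChoice_isSubZmodule of kernel by <:].
HB.instance Definition _ := [SubZmodule_isSubLmodule of kernel by <:].

Fact kernel_val_linear : linear kernel_val.
Proof. by move=> a u v; rewrite -[kernel_val]/(val) linearP. Qed.

End Kernel.

Lemma kernel_exists A B (f : {linear A -> B}) :
  exists (K : lmodType R) (i : {linear K -> A}), injective i /\ exact_at i f.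
Proof.
exists (kernel f : lmodType R), (lin (@kernel_val_linear _ _ f)); split.
  exact: val_inj.
move=> y; split=> [fy0|[[x /= /eqP fx] <-//]].
have yK : y \in ker_pred f by rewrite inE fy0.
by exists (Kernel yK).
Qed.

Section Cokernel.
Variables (A B : lmodType R) (f : {linear A -> B}).

Definition im_pred : {pred B} := [pred y | `[<exists x, f x = y>]].

Fact im_submod : submod_closed im_pred.
Proof.
split=> [|a u v]; rewrite !inE.
  by apply/asboolP; exists 0; rewrite raddf0.
move=> /asboolP[x <-] /asboolP[y <-]; apply/asboolP.
by exists (a *: x + y); rewrite linearP.
Qed.

HB.instance Definition _ := GRing.isSubmodClosed.Build R B im_pred im_submod.

(** The quotient construction supplies only the additive group; the scalar action is added below
    through representatives, and is well defined because the image is stable under scaling. *)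
Definition cokernel := {ideal_quot im_pred}.
HB.instance Definition _ := GRing.Zmodule.on cokernel.

Let pi (x : B) : cokernel := \pi x.

Let pi_eq x y : (pi x == pi y) = (x - y \in im_pred).
Proof. by rewrite Quotient.idealrBE. Qed.

Let piD x y : pi (x + y) = pi x + pi y.
Proof. exact: Quotient.pi_add. Qed.

Let piK (x : cokernel) : pi (repr x) = x.
Proof. exact: reprK. Qed.

Definition cokernel_scale a (x : cokernel) : cokernel := pi (a *: repr x).

Let piZ a x : cokernel_scale a (pi x) = pi (a *: x).
Proof.
apply/eqP; rewrite pi_eq -scalerBr rpredZ // -pi_eq.
by rewrite piK.
Qed.

Fact cokernel_scaleA a b v :
  cokernel_scale a (cokernel_scale b v) = cokernel_scale (a * b) v.
Proof. by rewrite -[v]piK !piZ scalerA. Qed.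
Fact cokernel_scale1 : left_id 1 cokernel_scale.
Proof. by move=> v; rewrite -[v]piK !piZ scale1r. Qed.
Fact cokernel_scaleDr : right_distributive cokernel_scale +%R.
Proof.
by move=> a u v; rewrite -[u]piK -[v]piK -piD !piZ scalerDr piD.
Qed.
Fact cokernel_scaleDl v : {morph cokernel_scale^~ v : a b / a + b}.
Proof. by move=> a b; rewrite -[v]piK !piZ scalerDl piD. Qed.

HB.instance Definition _ := GRing.Zmodule_isLmodule.Build R cokernel
  cokernel_scaleA cokernel_scale1 cokernel_scaleDr cokernel_scaleDl.

Fact cokernel_pi_linear : linear pi.
Proof. by move=> a u v; rewrite piD -piZ. Qed.

Fact cokernel_exact :
  surj (lin cokernel_pi_linear) /\ exact_at f (lin cokernel_pi_linear).
Proof.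
split=> [y|y]; first by exists (repr y); rewrite /= piK.
have -> : (lin cokernel_pi_linear y = 0) <-> (pi y == pi 0).
  have -> : pi 0 = 0 by exact: (raddf0 (lin cokernel_pi_linear)).
  by split=> /eqP.
by rewrite pi_eq subr0 inE; split=> [/asboolP|?]; last exact/asboolP.
Qed.

End Cokernel.

Lemma cokernel_exists A B (f : {linear A -> B}) :
  exists (C : lmodType R) (p : {linear B -> C}), surj p /\ exact_at f p.
Proof. exact: (ex_intro _ _ (ex_intro _ _ (cokernel_exact f))). Qed.

Lemma lift_inj A B X (i : {linear A -> B}) (f : {linear X -> B}) :
  injective i -> (forall x, exists a, i a = f x) ->
  exists h : {linear X -> A}, forall x, i (h x) = f x.
Proof.
move=> inj_i /choice[h hE].
have lh : linear h.
  by move=> a u v; apply: inj_i; rewrite linearP !hE linearP.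
by exists (lin lh).
Qed.

(** The chosen section [s] need not be linear; [f \o s] is, since [f] is constant on the fibres of
    [p]. *)
Lemma desc_surj A B X (p : {linear A -> B}) (f : {linear A -> X}) :
  surj p -> (forall a, p a = 0 -> f a = 0) ->
  exists h : {linear B -> X}, forall a, h (p a) = f a.
Proof.
move=> /choice[s sE] fK.
have fE a b : p a = p b -> f a = f b.
  by move=> pab; apply/subr0_eq; rewrite -linearB fK // linearB pab subrr.
have lh : linear (f \o s).
  by move=> a u v /=; rewrite -linearP; apply: fE; rewrite linearP !sE.
by exists (lin lh) => a /=; apply: fE.
Qed.

End LinearMaps.

(** * Short exact sequences *)

Section ModuleConstructions.
Variable R : pzRingType.
Implicit Types (A B C D E K L P Q X Y Z QA QC PA PC : lmodType R).

Fact comp_linear A B C (g : {linear B -> C}) (f : {linear A -> B}) :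
  linear (fun x => g (f x)).
Proof. by move=> a u v; rewrite !linearP. Qed.
Definition lcomp A B C (g : {linear B -> C}) (f : {linear A -> B}) :
  {linear A -> C} := lin (comp_linear g f).

Fact id_linear A : linear (fun x : A => x).
Proof. by []. Qed.
Definition lid A : {linear A -> A} := lin (@id_linear A).

Fact zero_linear A B : linear (fun _ : A => 0 : B).
Proof. by move=> a u v; rewrite scaler0 addr0. Qed.
Definition lzero A B : {linear A -> B} := lin (@zero_linear A B).

Fact sub_linear A B (f g : {linear A -> B}) : linear (fun x => f x - g x).
Proof.
by move=> a u v; rewrite !linearP addrACA scalerDr.
Qed.
Definition lsub A B (f g : {linear A -> B}) : {linear A -> B} :=
  lin (sub_linear f g).

Fact opp_linear A B (f : {linear A -> B}) : linear (fun x => - f x).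
Proof. by move=> a u v; rewrite !linearP. Qed.
Definition lopp A B (f : {linear A -> B}) : {linear A -> B} :=
  lin (opp_linear f).

Fact pair_linear X A B (f : {linear X -> A}) (g : {linear X -> B}) :
  linear (fun x => (f x, g x)).
Proof. by move=> a u v; rewrite !linearP. Qed.
Definition lpair X A B (f : {linear X -> A}) (g : {linear X -> B}) :
  {linear X -> (A * B)%type} := lin (pair_linear f g).

Fact copair_linear X A B (f : {linear A -> X}) (g : {linear B -> X}) :
  linear (fun z : A * B => f z.1 + g z.2).
Proof. by move=> a [u u'] [v v'] /=; rewrite !linearP scalerDr addrACA. Qed.
Definition lcopair X A B (f : {linear A -> X}) (g : {linear B -> X}) :
  {linear (A * B)%type -> X} := lin (copair_linear f g).

Fact fst_linear A B : linear (fun z : A * B => z.1).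
Proof. by []. Qed.
Definition lfst A B : {linear (A * B)%type -> A} := lin (@fst_linear A B).
Fact snd_linear A B : linear (fun z : A * B => z.2).
Proof. by []. Qed.
Definition lsnd A B : {linear (A * B)%type -> B} := lin (@snd_linear A B).

Definition linl A B : {linear A -> (A * B)%type} := lpair (lid A) (lzero A B).
Definition linr A B : {linear B -> (A * B)%type} := lpair (lzero B A) (lid B).

Lemma exact0 A B C (f : {linear A -> B}) (g : {linear B -> C}) :
  short_exact f g -> forall x, g (f x) = 0.
Proof. by case=> _ fg _ x; apply/fg; exists x. Qed.

Lemma lin_inj A B (f : {linear A -> B}) :
  (forall x, f x = 0 -> x = 0) -> injective f.
Proof.
by move=> f0 x y fxy; apply/subr0_eq/f0; rewrite linearB fxy subrr.
Qed.

Lemma split_exact A B : short_exact (linl A B) (lsnd A B).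
Proof.
split=> [x y [] //|[a b]|b]; last by exists (0, b).
by split=> [/= ->|[x [_ <-]]]; first by exists a.
Qed.

Lemma split_exact_l A B : short_exact (linr A B) (lfst A B).
Proof.
split=> [x y [] //|[a b]|a]; last by exists (a, 0).
by split=> [/= ->|[x [<- _]]]; first by exists b.
Qed.

Lemma exact_prod A B C A' B' C' (f : {linear A -> B}) (g : {linear B -> C})
    (f' : {linear A' -> B'}) (g' : {linear B' -> C'}) :
  short_exact f g -> short_exact f' g' ->
  short_exact (lpair (lcomp f (lfst A A')) (lcomp f' (lsnd A A')))
              (lpair (lcomp g (lfst B B')) (lcomp g' (lsnd B B'))).
Proof.
move=> [fi fg gs] [fi' fg' gs']; split.
- by move=> [x x'] [y y'] [/= /fi -> /fi' ->].
- move=> [y y']; split=> /= [[/fg[x <-] /fg'[x' <-]]|[[x x'] [<- <-]]].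
    by exists (x, x').
  by congr pair; [apply/fg; exists x | apply/fg'; exists x'].
- by move=> [z z']; have [y <-] := gs z; have [y' <-] := gs' z'; exists (y, y').
Qed.

(** Views an isomorphism as a short exact sequence with a zero end, so that closure under extensions
    yields closure under isomorphisms. *)
Lemma iso_exact A B (f : {linear A -> B}) (g : {linear B -> A}) Z :
  cancel f g -> cancel g f -> (forall z : Z, z = 0) ->
  short_exact (lzero Z A) f /\ short_exact f (lzero B Z).
Proof.
move=> fK gK Z0; split; split.
- by move=> x y _; rewrite (Z0 x); apply/esym/Z0.
- move=> y; split=> [fy|[x <-]]; last by rewrite linear0.
  by exists 0; rewrite /= -(fK y) fy linear0.
- by move=> b; exists (g b); apply: gK.
- exact: can_inj fK.
- by move=> b; split=> // _; exists (g b); apply: gK.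
- by move=> z; exists 0; rewrite (Z0 (_ _)).
Qed.

Lemma mod_iso_sym A B : mod_iso A B -> mod_iso B A.
Proof. by move=> [f [g [fK gK]]]; exists g, f. Qed.

Lemma mod_iso_refl A : mod_iso A A.
Proof. by exists (lid A), (lid A). Qed.

Lemma mod_iso_prodC A B : mod_iso (A * B)%type (B * A)%type.
Proof.
by exists (lpair (lsnd A B) (lfst A B)), (lpair (lsnd B A) (lfst B A));
   split=> [[]|[]].
Qed.

Lemma retraction_iso A B C (f : {linear A -> B}) (g : {linear B -> C})
    (r : {linear B -> A}) :
  short_exact f g -> (forall a, r (f a) = a) ->
  exists s : {linear C -> B}, [/\ forall c, g (s c) = c,
    forall b, f (r b) + s (g b) = b & mod_iso (A * C)%type B].
Proof.
move=> e rf; case: (e) => _ fg gs.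
have [s sE] : exists s : {linear C -> B}, forall b, s (g b) = b - f (r b).
  have := desc_surj (f := lsub (lid B) (lcomp f r)) gs; case=> [b /fg[a <-]|].
    by rewrite /= rf subrr.
  by move=> s sE; exists s.
have gsK c : g (s c) = c.
  by have [b <-] := gs c; rewrite sE linearB (exact0 e) subr0.
have frs b : f (r b) + s (g b) = b by rewrite sE addrC subrK.
exists s; split=> //; exists (lcopair f s), (lpair r g); split=> [[a c]|b] //=.
have rs : r (s c) = 0.
  by have [b <-] := gs c; rewrite sE linearB rf subrr.
by rewrite !linearD rf rs gsK (exact0 e) addr0 add0r.
Qed.

Lemma section_retraction A B C (f : {linear A -> B}) (g : {linear B -> C})
    (s : {linear C -> B}) :
  short_exact f g -> (forall c, g (s c) = c) ->
  exists r : {linear B -> A}, forall a, r (f a) = a.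
Proof.
move=> e gsK; case: (e) => fi fg gs.
have [b|r rE] := lift_inj (f := lsub (lid B) (lcomp s g)) fi.
  by apply/fg; rewrite /= linearB gsK subrr.
by exists r => a; apply: fi; rewrite rE /= (exact0 e) linear0 subr0.
Qed.

Lemma pushout_mono A B K A' (f : {linear A -> B}) (g : {linear B -> K})
    (u : {linear A -> A'}) :
  short_exact f g ->
  exists (E : lmodType R) (f' : {linear A' -> E}) (g' : {linear E -> K})
    (u' : {linear B -> E}),
  [/\ short_exact f' g', forall a, u' (f a) = f' (u a),
      forall b, g' (u' b) = g b &
      forall y, exists b a, y = u' b + f' a].
Proof.
move=> ef; case: (ef) => fi fg gs.
have [E [p [ps pE]]] := cokernel_exists (lpair f (lopp u)).
pose f' := lcomp p (linr B A'); pose u' := lcomp p (linl B A').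
have uf a : u' (f a) = f' (u a).
  apply/subr0_eq; rewrite /= -linearB; apply/pE; exists a => /=.
  by congr pair; rewrite ?subr0 ?sub0r.
have [[b a'] /pE[a [<- <-]]|g' g'E] :=
    desc_surj (f := lcopair g (lzero A' K)) ps.
  by rewrite /= (exact0 ef) addr0.
have pD b a' : p (b, a') = u' b + f' a'.
  by rewrite /= -linearD; congr (p _); congr pair; rewrite /= ?addr0 ?add0r.
have gu b : g' (u' b) = g b by rewrite g'E /= addr0.
have gf a : g' (f' a) = 0 by rewrite g'E /= linear0 addr0.
exists E, f', g', u'; split=> //; last first.
  by move=> y; have [[b a'] <-] := ps y; exists b, a'.
split.
- apply: lin_inj => a' /pE[a [fa <-]].
  by have -> : a = 0; [apply: fi; rewrite fa linear0 | rewrite linear0 oppr0].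
- move=> y; have [[b a'] <-] := ps y; rewrite pD.
  split=> [|[x <-]]; last exact: gf.
  rewrite linearD gu gf addr0 => /fg[a <-].
  by exists (u a + a'); rewrite linearD uf.
- by move=> c; have [b <-] := gs c; exists (u' b).
Qed.

(** Serves to trade one extension for another: the pushout [E] is at once an extension of [C] by
    [A'] and of [K] by [B], and in many uses one of the two splits. *)
Lemma pushout_exact A B C A' K (f : {linear A -> B}) (g : {linear B -> C})
    (u : {linear A -> A'}) (w : {linear A' -> K}) :
  short_exact f g -> short_exact u w ->
  exists (E : lmodType R) (f' : {linear A' -> E}) (g' : {linear E -> C})
    (u' : {linear B -> E}) (w' : {linear E -> K}),
  short_exact f' g' /\ short_exact u' w'.
Proof.
move=> ef eu; case: (ef) => fi fg gs; case: (eu) => ui uw ws.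
have [E [f' [g' [u' [ef' uf gu surj_uf]]]]] := pushout_mono u ef.
have [f'i fg' _] := ef'.
have rel b a' : u' b + f' a' = 0 -> exists2 a, b = f a & a' = - u a.
  move=> ba; have /fg[a aE] : g b = 0.
    have := congr1 g' ba.
    by rewrite linearD gu (exact0 ef') addr0 linear0.
  exists a => //; apply: f'i; rewrite linearN -uf aE; apply/eqP.
  by rewrite -addr_eq0 addrC ba.
have [y|[b a'] /= /rel[a _ ->]|w' w'E] :=
    desc_surj (p := lcopair u' f') (f := lcopair (lzero B K) w).
- by have [b [a ->]] := surj_uf y; exists (b, a).
- by rewrite add0r linearN (exact0 eu) oppr0.
have wf a : w' (f' a) = w a.
  by have := w'E (0, a); rewrite /= !linear0 !add0r.
have wu b : w' (u' b) = 0.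
  by have := w'E (b, 0); rewrite /= !linear0 !addr0.
exists E, f', g', u', w'; split=> //; split.
- apply: lin_inj => b ub; have [|a ->] := rel b 0.
    by rewrite ub linear0 addr0.
  move=> /esym/eqP; rewrite oppr_eq0 => /eqP ua.
  by have -> : a = 0; [apply: ui; rewrite ua linear0 | rewrite linear0].
- move=> y; have [b [a' ->]] := surj_uf y.
  split=> [|[x <-]]; last exact: wu.
  rewrite linearD wu wf add0r => /uw[a <-].
  by exists (b + f a); rewrite linearD uf.
- by move=> c; have [b <-] := ws c; exists (f' b).
Qed.

Lemma pullback_epi A B C X (f : {linear A -> B}) (g : {linear B -> C})
    (u : {linear X -> C}) :
  short_exact f g ->
  exists (E : lmodType R) (f' : {linear A -> E}) (g' : {linear E -> X})
    (u' : {linear E -> B}),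
  [/\ short_exact f' g', forall a, u' (f' a) = f a,
      forall y, g (u' y) = u (g' y) &
      forall b x, g b = u x -> exists y, u' y = b /\ g' y = x].
Proof.
move=> ef; case: (ef) => fi fg gs.
have [E [i [ii iE]]] := kernel_exists (lcopair g (lopp u)).
have iP z : g z.1 = u z.2 -> exists y, i y = z.
  by move=> h; apply/iE; rewrite /= h subrr.
have [a|f' f'E] := lift_inj (f := lpair f (lzero A X)) ii.
  by apply: iP; rewrite /= linear0 (exact0 ef).
pose g' := lcomp (lsnd B X) i; pose u' := lcomp (lfst B X) i.
have sq y : g (u' y) = u (g' y).
  by apply/subr0_eq; have /iE : exists x, i x = i y by exists y.
exists E, f', g', u'; split=> //; first split.
- by move=> a b /(congr1 i); rewrite !f'E => -[] /fi.
- move=> y; split=> [gy|[x <-]]; last by rewrite /= f'E.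
  have /fg[a fa] : g (u' y) = 0 by rewrite sq gy linear0.
  exists a; apply: ii; rewrite f'E; move: gy fa; rewrite /u' /=.
  by case: (i y) => /= ? ? -> ->.
- move=> x; have [b gb] := gs (u x); have [y iy] := iP (b, x) gb.
  by exists y; rewrite /= iy.
- by move=> a; rewrite /= f'E.
- by move=> b x /(iP (b, x))[y iy]; exists y; rewrite /= iy.
Qed.

Lemma pullback_exact A B C K P (f : {linear A -> B}) (g : {linear B -> C})
    (i : {linear K -> P}) (p : {linear P -> C}) :
  short_exact f g -> short_exact i p ->
  exists (E : lmodType R) (f' : {linear A -> E}) (g' : {linear E -> P})
    (i' : {linear K -> E}) (p' : {linear E -> B}),
  [/\ short_exact f' g' & short_exact i' p'].
Proof.
move=> ef ep; case: (ep) => ii ip ps.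
have [E [f' [g' [u' [ef' uf sq EP]]]]] := pullback_epi p ef.
have [_ fg' _] := ef'.
have jointly y : u' y = 0 -> g' y = 0 -> y = 0.
  move=> uy /fg'[a ya]; move: uy; rewrite -ya uf => fa.
  case: ef => fi _ _; have -> : a = 0 by apply: fi; rewrite fa linear0.
  by rewrite linear0.
(* An element of the pullback is determined by its two projections, so the lift of [(0, i k)] is
   unique, hence linear in [k]. *)
have : forall k, exists y, u' y = 0 /\ g' y = i k.
  by move=> k; apply: EP; rewrite linear0 (exact0 ep).
move=> /choice[h hE].
have lh : linear h.
  move=> a u v; apply/subr0_eq/jointly.
    by rewrite linearB linearP !(hE _).1 scaler0 addr0 subrr.
  by rewrite linearB linearP !(hE _).2 linearP subrr.
exists E, f', g', (lin lh), u'; split=> //; split.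
- by move=> x y hxy; apply: ii; rewrite -!(hE _).2; congr (g' _).
- move=> y; split=> [uy|[x <-]]; last exact: (hE x).1.
  have /ip[k kE] : p (g' y) = 0 by rewrite -sq uy linear0.
  exists k; apply/subr0_eq/jointly; rewrite linearB /=.
    by rewrite (hE _).1 uy subrr.
  by rewrite (hE _).2 kE subrr.
- move=> b; have [x px] := ps (g b).
  by have [y [uy _]] := EP b x (esym px); exists y.
Qed.

(** Third isomorphism theorem: for A inside B inside D, the quotient D/A is an extension of D/B by
    B/A. *)
Lemma exact_comp_mono A B D K1 K2 (f : {linear A -> B}) (g : {linear B -> K1})
    (u : {linear B -> D}) (w : {linear D -> K2}) :
  short_exact f g -> short_exact u w ->
  exists (K : lmodType R) (q : {linear D -> K}) (i : {linear K1 -> K})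
    (p : {linear K -> K2}),
  short_exact (lcomp u f) q /\ short_exact i p.
Proof.
move=> ef eu; case: (ef) => fi fg gs; case: (eu) => ui uw ws.
have [K [q [qs qE]]] := cokernel_exists (lcomp u f).
have [b /fg[a <-]|i iE] := desc_surj (f := lcomp q u) gs.
  by apply/qE; exists a.
have [d /qE[a <-]|p pE] := desc_surj (f := w) qs.
  exact: exact0 eu _.
exists K, q, i, p; split=> //; split=> //.
- by move=> x y /ui /fi.
- apply: lin_inj => k1; have [b <-] := gs k1; rewrite iE => /qE[a /ui <-].
  exact: exact0 ef _.
- move=> k; have [d <-] := qs k; rewrite pE; split=> [/uw[b <-]|[k1 /esym]].
    by exists (g b); rewrite iE.
  have [b <-] := gs k1; rewrite iE => /= /esym qd.
  by rewrite -pE -qd /= pE (exact0 eu).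
- by move=> k2; have [d <-] := ws k2; exists (q d).
Qed.

(** The module [P] is the preimage of [C] in [D]. *)
Lemma exact_comp_epi L D E C K (l : {linear L -> D}) (p : {linear D -> E})
    (c : {linear C -> E}) (q : {linear E -> K}) :
  short_exact l p -> short_exact c q ->
  exists (P : lmodType R) (j : {linear P -> D}) (l' : {linear L -> P})
    (p' : {linear P -> C}),
  [/\ short_exact j (lcomp q p), short_exact l' p',
      forall x, j (l' x) = l x & forall x, c (p' x) = p (j x)].
Proof.
move=> el eq; case: (el) => li lp ps; case: (eq) => ci cq qs.
have [P [j [ji jE]]] := kernel_exists (lcomp q p).
have [x|l' l'E] := lift_inj (f := l) ji.
  by apply/jE; rewrite /= (exact0 el) linear0.
have [x|p' p'E] := lift_inj (f := lcomp p j) ci.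
  by apply/cq/(jE (j x)); exists x.
exists P, j, l', p'; split=> //; split=> //.
- by move=> k; have [e <-] := qs k; have [d <-] := ps e; exists d.
- by move=> x y /(congr1 j); rewrite !l'E => /li.
- move=> y; split=> [py|[x <-]].
    have /lp[x lx] : p (j y) = 0 by rewrite -[LHS]p'E py linear0.
    by exists x; apply: ji; rewrite l'E.
  by apply: ci; rewrite p'E /= l'E (exact0 el) linear0.
- move=> y; have [d dE] := ps (c y).
  have [x jx] : exists x, j x = d by apply/jE; rewrite /= dE (exact0 eq).
  by exists x; apply: ci; rewrite p'E /= jx.
Qed.

(** Horseshoe lemma for monomorphisms: [u] and [c \o g] together embed [B], and [B'] is the
    cokernel. In the uses, [u] is supplied by Ext^1(C, QA) = 0. *)
Lemma horseshoe_mono A B C QA QC A' C'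
    (f : {linear A -> B}) (g : {linear B -> C})
    (a : {linear A -> QA}) (a' : {linear QA -> A'})
    (c : {linear C -> QC}) (c' : {linear QC -> C'}) (u : {linear B -> QA}) :
  short_exact f g -> short_exact a a' -> short_exact c c' ->
  (forall x, u (f x) = a x) ->
  exists (B' : lmodType R) (b : {linear B -> (QA * QC)%type})
    (b' : {linear (QA * QC)%type -> B'})
    (f' : {linear A' -> B'}) (g' : {linear B' -> C'}),
  short_exact b b' /\ short_exact f' g'.
Proof.
move=> ef ea ec uf.
case: (ef) => fi fg gs; case: (ea) => ai aa as'; case: (ec) => ci cc cs.
pose b := lpair u (lcomp c g).
have [B' [b' [bs bE]]] := cokernel_exists b.
have [x /aa[y <-]|f' f'E] := desc_surj (f := lcomp b' (linl QA QC)) as'.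
  apply/bE; exists (f y); rewrite /= uf; congr pair.
  by rewrite (exact0 ef) linear0.
have [[x y] /bE[z [_ <-]]|g' g'E] := desc_surj (f := lcomp c' (lsnd QA QC)) bs.
  exact: exact0 ec _.
exists B', b, b', f', g'; split; split=> //.
- apply: lin_inj => x [ux /eqP]; rewrite -(linear0 c) => /eqP /ci /fg[y yE].
  move: ux; rewrite -yE uf => ay.
  by have -> : y = 0; [apply: ai; rewrite ay linear0 | rewrite linear0].
- apply: lin_inj => x; have [y <-] := as' x.
  rewrite f'E => /bE[z [zy /eqP]]; rewrite -(linear0 c) => /eqP /ci /fg[t tz].
  by rewrite -zy -tz uf (exact0 ea).
- move=> z; have [[x y] <-] := bs z; rewrite g'E /=.
  split=> [/cc[t ty]|[t]].
    have [s sE] := gs t; exists (a' (x - u s)); rewrite f'E.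
    apply/subr0_eq; rewrite /= -linearB; apply/bE; exists (- s).
    rewrite /= !linearN sE ty; congr pair; rewrite ?sub0r //=.
    by rewrite addrAC subrr add0r.
  have [s <-] := as' t; rewrite f'E => /esym bxy.
  have := g'E (x, y); rewrite bxy g'E /= linear0 => <-.
  by [].
- by move=> z; have [y <-] := cs z; exists (b' (0, y)); rewrite g'E.
Qed.

Lemma horseshoe_epi A B C PA PC A' C'
    (f : {linear A -> B}) (g : {linear B -> C})
    (a : {linear A' -> PA}) (a' : {linear PA -> A})
    (c : {linear C' -> PC}) (c' : {linear PC -> C}) (v : {linear PC -> B}) :
  short_exact f g -> short_exact a a' -> short_exact c c' ->
  (forall x, g (v x) = c' x) ->
  exists (B' : lmodType R) (b : {linear B' -> (PA * PC)%type})
    (b' : {linear (PA * PC)%type -> B})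
    (f' : {linear A' -> B'}) (g' : {linear B' -> C'}),
  short_exact b b' /\ short_exact f' g'.
Proof.
move=> ef ea ec gv.
case: (ef) => fi fg gs; case: (ea) => ai aa as'; case: (ec) => ci cc cs.
pose b' := lcopair (lcomp f a') v.
have gb z : g (b' z) = c' z.2.
  by rewrite /= linearD (exact0 ef) add0r gv.
have [B' [b [bi bE]]] := kernel_exists b'.
have b0 x : b' (b x) = 0 by apply/bE; exists x.
have [x|f' f'E] := lift_inj (f := lcomp (linl PA PC) a) bi.
  by apply/bE; rewrite /= (exact0 ea) !linear0 addr0.
have [x|g' g'E] := lift_inj (f := lcomp (lsnd PA PC) b) ci.
  by apply/cc; rewrite /= -gb b0 linear0.
exists B', b, b', f', g'; split; split=> //.
- move=> y; have [z zE] := cs (g y).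
  have /fg[x xE] : g (y - v z) = 0 by rewrite linearB gv zE subrr.
  have [w wE] := as' x; exists (w, z).
  by rewrite /= wE xE subrK.
- by move=> x y /(congr1 b); rewrite !f'E => -[/ai].
- move=> x; split=> [gx|[y <-]]; last first.
    by apply: ci; rewrite g'E /= f'E linear0.
  have b2 : (b x).2 = 0 by have := g'E x; rewrite gx linear0.
  have /aa[y yE] : a' (b x).1 = 0.
    apply: fi; have := b0 x; rewrite /= b2 linear0 addr0 => ->.
    by rewrite linear0.
  exists y; apply: bi; rewrite f'E /= yE.
  by move: b2; case: (b x) => /= ? ? ->.
- move=> x; have /fg[y yE] : g (v (c x)) = 0 by rewrite gv (exact0 ec).
  have [w wE] := as' y.
  have [z zE] : exists z, b z = (- w, c x).
    by apply/bE; rewrite /= !linearN wE yE addNr.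
  by exists z; apply: ci; rewrite g'E /= zE.
Qed.

End ModuleConstructions.

(** * Vanishing of Ext^1 and Gorenstein projectives *)

Section GorensteinProjectives.
Variable R : pzRingType.
Implicit Types (A B C D E K L P Q X Y Z : lmodType R).

Lemma projective_prod P Q :
  projective P -> projective Q -> projective (P * Q)%type.
Proof.
move=> projP projQ A B g f sg.
have [h hE] := projP A B g (lcomp f (linl P Q)) sg.
have [k kE] := projQ A B g (lcomp f (linr P Q)) sg.
exists (lcopair h k) => -[x y] /=; rewrite linearD hE kE /= -linearD.
by congr (f _); congr pair; rewrite /= ?addr0 ?add0r.
Qed.

Lemma projective0 Z : (forall z : Z, z = 0) -> projective Z.
Proof.
move=> Z0 A B g f sg; exists (lzero Z A) => x.
by rewrite (Z0 x) !linear0.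
Qed.

Lemma zero_module_exists : exists Z, forall z : Z, z = 0.
Proof.
have [Z [i [ii iE]]] := kernel_exists (lid (R^o : lmodType R)).
exists Z => z; apply: ii; rewrite linear0.
by have /iE : exists x, i x = i z by exists z.
Qed.

(* [E1 X Y] says that Ext^1(X, Y) = 0, without choosing a resolution. *)
Definition E1 X Y : Prop :=
  forall A B (f : {linear A -> B}) (g : {linear B -> X}), short_exact f g ->
  forall h : {linear A -> Y}, exists h' : {linear B -> Y},
  forall a, h' (f a) = h a.

Lemma E1_split X Y B (f : {linear Y -> B}) (g : {linear B -> X}) :
  E1 X Y -> short_exact f g ->
  exists r : {linear B -> Y}, forall y, r (f y) = y.
Proof. by move=> e s; have [r rE] := e _ _ _ _ s (lid Y); exists r. Qed.

Lemma E1_section X Y B (f : {linear Y -> B}) (g : {linear B -> X}) :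
  E1 X Y -> short_exact f g ->
  exists s : {linear X -> B}, forall x, g (s x) = x.
Proof.
move=> e s; have [r rE] := E1_split e s.
by have [t [tE _ _]] := retraction_iso s rE; exists t.
Qed.

Lemma E1_iso X Y B (f : {linear Y -> B}) (g : {linear B -> X}) :
  E1 X Y -> short_exact f g -> mod_iso (Y * X)%type B.
Proof.
move=> e s; have [r rE] := E1_split e s.
by have [t [_ _]] := retraction_iso s rE.
Qed.

Lemma E1_projective P Y : projective P -> E1 P Y.
Proof.
move=> projP A B f g s h; have [_ _ gs] := s.
have [t tE] := projP _ _ g (lid P) gs.
have [r rE] := section_retraction s tE.
by exists (lcomp h r) => a; rewrite /= rE.
Qed.

(** Every extension of [X] is a pushout of the given presentation: its middle term [B] is a quotient
    of [A * P], on which [h] and the extended map glue. *)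
Lemma E1_presentation L P X Y (i : {linear L -> P}) (p : {linear P -> X}) :
  short_exact i p -> projective P ->
  (forall h : {linear L -> Y}, exists h' : {linear P -> Y},
     forall x, h' (i x) = h x) -> E1 X Y.
Proof.
move=> s projP ext A B f g t h; case: (s) => ii ip ps; case: (t) => fi fg gs.
have [u uE] := projP _ _ g p gs.
have [x|u' u'E] := lift_inj (f := lcomp u i) fi.
  by apply/fg; rewrite /= uE (exact0 s).
have [k kE] := ext (lcomp h u').
have [| |h' h'E] := desc_surj (p := lcopair f u) (f := lcopair h k).
- move=> b; have [x xE] := ps (g b).
  have /fg[a aE] : g (b - u x) = 0 by rewrite linearB uE xE subrr.
  by exists (a, x); rewrite /= aE subrK.
- move=> [a x] /= fau.
  have /ip[y yE] : p x = 0.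
    by rewrite -uE -[LHS]add0r -{1}(exact0 t a) -linearD fau linear0.
  have aE : a = - u' y.
    by apply: fi; rewrite linearN u'E /= yE; apply/eqP; rewrite -addr_eq0 fau.
  by rewrite aE -yE kE /= linearN addNr.
by exists h' => a; have := h'E (a, 0); rewrite /= !linear0 !addr0.
Qed.

Lemma E1_lift X A B C (f : {linear A -> B}) (g : {linear B -> C})
    (u : {linear X -> C}) :
  short_exact f g -> E1 X A ->
  exists v : {linear X -> B}, forall x, g (v x) = u x.
Proof.
move=> s e; have [E [f' [g' [u' [s' _ sq _]]]]] := pullback_epi u s.
have [t tE] := E1_section e s'.
by exists (lcomp u' t) => x; rewrite /= sq tE.
Qed.

(** A map is extended first to the preimage of [A] in the middle term, then from there to the whole
    of it. *)
Lemma E1_ext_l A B C Y (f : {linear A -> B}) (g : {linear B -> C}) :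
  short_exact f g -> E1 A Y -> E1 C Y -> E1 B Y.
Proof.
move=> s eA eC D E i p t h.
have [P [j [i' [p' [sj si ji _]]]]] := exact_comp_epi t s.
have [k kE] := eA _ _ _ _ si h; have [m mE] := eC _ _ _ _ sj k.
by exists m => x; rewrite -ji mE kE.
Qed.

Lemma E1_retract_l X X' Y (s : {linear X -> X'}) (r : {linear X' -> X}) :
  (forall x, r (s x) = x) -> E1 X' Y -> E1 X Y.
Proof.
move=> rs e A B f g t h.
have [K [i [ii iE]]] := kernel_exists r; case: (t) => fi fg gs.
have ri k : r (i k) = 0 by apply/iE; exists k.
(* [X'] is [K] plus the image of [s], so adding [K] to the middle term turns the extension of [X]
   into one of [X']. *)
have t' : short_exact (lcomp (linr K B) f) (lcopair i (lcomp s g)).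
  split=> [x y [/fi] //|[k b]|x].
    split=> /= [kb|[a [<- <-]]]; last by rewrite (exact0 t) !linear0 addr0.
    have gb : g b = 0.
      by have := congr1 r kb; rewrite linearD ri rs add0r linear0.
    have /fg[a <-] := gb; exists a; congr pair; apply: ii.
    by rewrite linear0 -kb gb linear0 addr0.
  have /iE[k kE] : r (x - s (r x)) = 0 by rewrite linearB rs subrr.
  have [b bE] := gs (r x); exists (k, b).
  by rewrite /= kE bE subrK.
have [k kE] := e _ _ _ _ t' h.
by exists (lcomp k (linr K B)) => a; rewrite -kE.
Qed.

Lemma E1_retract_r X Y Y' (s : {linear Y -> Y'}) (r : {linear Y' -> Y}) :
  (forall y, r (s y) = y) -> E1 X Y' -> E1 X Y.
Proof.
move=> rs e A B f g t h; have [k kE] := e _ _ _ _ t (lcomp s h).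
by exists (lcomp r k) => a; rewrite /= kE /= rs.
Qed.

(** The extension of [g \o h] to [P] lifts to [B] by projectivity; its discrepancy with [h] takes
    values in [A] and is extended there. *)
Lemma E1_ext_r L P X A B C (i : {linear L -> P}) (p : {linear P -> X})
    (f : {linear A -> B}) (g : {linear B -> C}) :
  short_exact i p -> projective P -> short_exact f g ->
  E1 X A -> E1 X C -> E1 X B.
Proof.
move=> s projP t eA eC; apply: (E1_presentation s projP) => h.
case: (t) => fi fg gs.
have [k kE] := eC _ _ _ _ s (lcomp g h); have [k' k'E] := projP _ _ g k gs.
have [x|m mE] := lift_inj (f := lsub h (lcomp k' i)) fi.
  by apply/fg; rewrite /= linearB k'E kE subrr.
have [m' m'E] := eA _ _ _ _ s m.
exists (lsub k' (lopp (lcomp f m'))) => x /=.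
by rewrite opprK m'E mE /= addrC subrK.
Qed.

(** A piece of the long exact sequence: [E1 L A] stands for Ext^2(X, A) = 0, and Ext^1(X, C) lies
    between Ext^1(X, B) and Ext^2(X, A). *)
Lemma E1_cone L P X A B C (i : {linear L -> P}) (p : {linear P -> X})
    (f : {linear A -> B}) (g : {linear B -> C}) :
  short_exact i p -> projective P -> short_exact f g ->
  E1 X B -> E1 L A -> E1 X C.
Proof.
move=> s projP t eB eA; apply: (E1_presentation s projP) => h.
have [k kE] := E1_lift h t eA; have [m mE] := eB _ _ _ _ s k.
by exists (lcomp g m) => x; rewrite /= mE kE.
Qed.

(** A coinductive criterion: the sequences going up and down from [X] splice to a complete
    resolution, and the Ext^1 condition keeps it exact under Hom into projectives. Later proofs only
    exhibit a stable class and never touch complexes. *)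
Lemma gp_coind (S : lmodType R -> Prop) :
  (forall X Q, S X -> projective Q -> E1 X Q) ->
  (forall X, S X -> exists P X' (i : {linear X -> P}) (p : {linear P -> X'}),
     [/\ projective P, short_exact i p & S X']) ->
  (forall X, S X -> exists P X' (i : {linear X' -> P}) (p : {linear P -> X}),
     [/\ projective P, short_exact i p & S X']) ->
  forall X, S X -> gorenstein_projective X.
Proof.
move=> SE Sup Sdown X SX.
have up_ex (x : {X | S X}) : exists x' : {X | S X}, exists P
    (i : {linear sval x -> P}) (p : {linear P -> sval x'}),
    projective P /\ short_exact i p.
  have [P [X' [i [p [projP s SX']]]]] := Sup _ (svalP x).
  by exists (exist _ X' SX'), P, i, p.
have down_ex (x : {X | S X}) : exists x' : {X | S X}, exists P
    (i : {linear sval x' -> P}) (p : {linear P -> sval x}),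
    projective P /\ short_exact i p.
  have [P [X' [i [p [projP s SX']]]]] := Sdown _ (svalP x).
  by exists (exist _ X' SX'), P, i, p.
have [up upE] := choice up_ex; have [down downE] := choice down_ex.
pose x0 : {X | S X} := exist _ X SX.
(* [Negz m] is [- m.+1]: syzygies sit in positive degrees, cosyzygies in negative ones, and [X] in
   degree 0. The projective [P n] lies between [Xs (n + 1)] and [Xs n]. *)
pose Xs (n : int) := match n with
  | Posz m => iter m down x0 | Negz m => iter m.+1 up x0 end.
have step n : {P : lmodType R & {i : {linear sval (Xs (n + 1)) -> P} &
    {p : {linear P -> sval (Xs n)} | projective P /\ short_exact i p}}}.
  suff /cid[P /cid[i /cid[p H]]] : exists P
    (i : {linear sval (Xs (n + 1)) -> P}) (p : {linear P -> sval (Xs n)}),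
    projective P /\ short_exact i p by exists P, i, p.
  case: n => [m|[|m]].
  - have -> : Posz m + 1 = Posz m.+1 by rewrite -PoszD addn1.
    exact: downE.
  - exact: (upE x0).
  - have -> : Negz m.+1 + 1 = Negz m.
      by rewrite !NegzE -[in LHS]addn1 PoszD opprD subrK.
    exact: (upE (iter m.+1 up x0)).
pose P n := tag (step n).
pose i n : {linear sval (Xs (n + 1)) -> P n} := tag (tagged (step n)).
pose p n : {linear P n -> sval (Xs n)} := sval (tagged (tagged (step n))).
have projP n : projective (P n) := (svalP (tagged (tagged (step n)))).1.
have ex n : short_exact (i n) (p n) := (svalP (tagged (tagged (step n)))).2.
exists P, (fun n => lcomp (i n) (p (n + 1))); split=> //.
- move=> n y; case: (ex n) => ii _ _; case: (ex (n + 1)) => _ ip _.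
  split=> [/eqP|[x <-]]; last by rewrite /= (exact0 (ex _)) linear0.
  rewrite -(linear0 (i n)) => /eqP/ii/ip[x <-].
  by case: (ex (n + 1 + 1)) => _ _ ps; have [z <-] := ps x; exists z.
- move=> Q projQ n g; split=> [g0|[h hE] x]; last first.
    by rewrite -hE /= (exact0 (ex _)) !linear0.
  case: (ex (n + 1)) => _ ip ps.
  have [y /ip[x <-]|g' g'E] := desc_surj (f := g) ps.
    case: (ex (n + 1 + 1)) => _ _ ps'; have [z <-] := ps' x; exact: g0.
  have [h hE] := SE _ _ (svalP (Xs n)) projQ _ _ _ _ (ex n) g'.
  by exists h => x; rewrite /= hE g'E.
- have X0 : sval (Xs (- 2 + 1 + 1)) = X by [].
  case: (ex (- 2 + 1)) => ii ip _; case: (ex (- 2)) => ii' _ _.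
  move: (i (-2 + 1)) ii ip; rewrite X0 => j ji jp; exists j; split=> // y.
  rewrite -jp /=; split=> [|->]; last by rewrite linear0.
  by move=> /eqP; rewrite -(linear0 (i (- 2))) => /eqP/ii'.
Qed.

(** Converse of [gp_coind]: the class consists of all kernels of the differentials of one complete
    resolution. *)
Lemma gp_syzygies X : gorenstein_projective X -> exists S : lmodType R -> Prop,
  [/\ S X, forall X Q, S X -> projective Q -> E1 X Q,
  forall X, S X -> exists P X' (i : {linear X -> P}) (p : {linear P -> X'}),
     [/\ projective P, short_exact i p & S X'] &
  forall X, S X -> exists P X' (i : {linear X' -> P}) (p : {linear P -> X}),
     [/\ projective P, short_exact i p & S X']].
Proof.
move=> [P [d [projP acP homP [k0 [k0i k0E]]]]].
pose S Y := exists n (k : {linear Y -> P (n + 1)}),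
  injective k /\ exact_at k (d n).
have cover Y n (k : {linear Y -> P (n + 1)}) :
    injective k -> exact_at k (d n) ->
    exists L (i : {linear L -> P (n + 1 + 1)})
      (p : {linear P (n + 1 + 1) -> Y}),
    [/\ short_exact i p, exact_at i (d (n + 1)), injective i
      & forall x, k (p x) = d (n + 1) x].
  move=> ki kE.
  have [x|p pE] := lift_inj (f := d (n + 1)) ki.
    by apply/kE/acP; exists x.
  have [L [i [ii iE]]] := kernel_exists (d (n + 1)).
  exists L, i, p; split=> //; split=> //.
    move=> x; rewrite -iE -pE; split=> [->|]; first by rewrite linear0.
    by move=> /eqP; rewrite -(linear0 k) => /eqP/ki.
  move=> y; have /acP[x xE] : d n (k y) = 0 by apply/kE; exists y.
  by exists x; apply: ki; rewrite pE.
have mono Y n (k : {linear Y -> P (n + 1)}) :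
    injective k -> exact_at k (d n) ->
    exists Y' (p : {linear P (n + 1) -> Y'}), short_exact k p /\ S Y'.
  (* The cokernel of [k] is the next kernel, which sits in [P n]; this is the source of a
     differential only once [n] has the form [m + 1]. *)
  move: k; have [m ->] : exists m, n = m + 1 by exists (n - 1); rewrite subrK.
  move=> k ki kE; have [Y' [j [ji jE]]] := kernel_exists (d m).
  have [x|p pE] := lift_inj (f := d (m + 1)) ji.
    by apply/jE/acP; exists x.
  exists Y', p; split; last by exists m, j.
  split=> //.
    move=> x; rewrite -kE -pE; split=> [->|]; first by rewrite linear0.
    by move=> /eqP; rewrite -(linear0 j) => /eqP/ji.
  move=> y; have /acP[x xE] : d m (j y) = 0 by apply/jE; exists y.
  by exists x; apply: ji; rewrite pE.
exists S; split.
- by exists (- 2), k0.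
- move=> Y Q [n [k [ki kE]]] projQ.
  have [L [i [p [s iE ii kp]]]] := cover _ _ _ ki kE.
  apply: (E1_presentation s (projP _)) => h.
  (* Composed with the cover [q] of [L], the map [h] becomes a cocycle with values in [Q], and
     Hom-exactness produces the extension. *)
  have [M [j [q [t _ _ iq]]]] := cover _ _ _ ii iE.
  have [|h' h'E] := (homP Q projQ (n + 1 + 1) (lcomp h q)).1.
    move=> x /=; suff -> : q (d (n + 1 + 1 + 1) x) = 0 by rewrite linear0.
    by apply: ii; rewrite iq linear0; apply/acP; exists x.
  case: t => _ _ qs; exists h' => x; have [y <-] := qs x.
  by rewrite iq h'E.
- move=> Y [n [k [ki kE]]]; have [Y' [p [s SY']]] := mono _ _ _ ki kE.
  by exists (P (n + 1)), Y', k, p.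
- move=> Y [n [k [ki kE]]]; have [L [i [p [s iE ii _]]]] := cover _ _ _ ki kE.
  exists (P (n + 1 + 1)), L, i, p; split=> //.
  by exists (n + 1), i.
Qed.

End GorensteinProjectives.

(** * The Frobenius category GP(R) *)

Section FrobeniusStructure.
Variable R : pzRingType.
Implicit Types (A B C D E K L P Q X Y Z : lmodType R).
Notation gp := (@gorenstein_projective R).

Lemma gp_E1 X Q : gp X -> projective Q -> E1 X Q.
Proof. by move=> /gp_syzygies[S [SX SE _ _]]; apply: SE. Qed.

Lemma gp_embedding X : gp X ->
  exists P X' (i : {linear X -> P}) (p : {linear P -> X'}),
  [/\ projective P, short_exact i p & gp X'].
Proof.
move=> /gp_syzygies[S [SX SE Sup Sdown]].
have [P [X' [i [p [projP s SX']]]]] := Sup _ SX.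
exists P, X', i, p; split=> //; exact: (gp_coind SE Sup Sdown SX').
Qed.

Lemma gp_presentation X : gp X ->
  exists P X' (i : {linear X' -> P}) (p : {linear P -> X}),
  [/\ projective P, short_exact i p & gp X'].
Proof.
move=> /gp_syzygies[S [SX SE Sup Sdown]].
have [P [X' [i [p [projP s SX']]]]] := Sdown _ SX.
exists P, X', i, p; split=> //; exact: (gp_coind SE Sup Sdown SX').
Qed.

Lemma id_exact X Z : (forall z : Z, z = 0) ->
  short_exact (lzero Z X) (lid X) /\ short_exact (lid X) (lzero X Z).
Proof. by move=> Z0; apply: (iso_exact (f := lid X) (g := lid X)). Qed.

Lemma gp_projective P : projective P -> gp P.
Proof.
have [Z Z0] := zero_module_exists R.
apply: (gp_coind (S := @projective R)) => [X Q projX _|X projX|X projX].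
- exact: E1_projective.
- exists X, Z, (lid X), (lzero X Z); split=> //; last exact: projective0.
  by have [] := id_exact X Z0.
- exists X, Z, (lzero Z X), (lid X); split=> //; last exact: projective0.
  by have [] := id_exact X Z0.
Qed.

(** The two horseshoe lemmas show that extensions of Gorenstein projectives form a class as in
    [gp_coind]. *)
Lemma gp_extension A B C (f : {linear A -> B}) (g : {linear B -> C}) :
  short_exact f g -> gp A -> gp C -> gp B.
Proof.
move=> s gA gC.
pose S Y := exists A C (f : {linear A -> Y}) (g : {linear Y -> C}),
  [/\ short_exact f g, gp A & gp C].
apply: (gp_coind (S := S)); last by exists A, C, f, g.
- move=> X Q [A' [C' [f' [g' [s' gA' gC']]]]] projQ.
  by apply: (E1_ext_l s'); apply: gp_E1.
- move=> X [A' [C' [f' [g' [s' gA' gC']]]]].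
  have [PA [A1 [a [a' [projA ea gA1]]]]] := gp_embedding gA'.
  have [PC [C1 [c [c' [projC ec gC1]]]]] := gp_embedding gC'.
  have [u uf] := gp_E1 gC' projA s' a.
  have [X' [b [b' [f1 [g1 [eb e1]]]]]] := horseshoe_mono s' ea ec uf.
  exists (PA * PC)%type, X', b, b'; split=> //; first exact: projective_prod.
  by exists A1, C1, f1, g1.
- move=> X [A' [C' [f' [g' [s' gA' gC']]]]].
  have [PA [A1 [a [a' [projA ea gA1]]]]] := gp_presentation gA'.
  have [PC [C1 [c [c' [projC ec gC1]]]]] := gp_presentation gC'.
  have [_ _ gs] := s'; have [v gv] := projC _ _ g' c' gs.
  have [X' [b [b' [f1 [g1 [eb e1]]]]]] := horseshoe_epi s' ea ec gv.
  exists (PA * PC)%type, X', b, b'; split=> //; first exact: projective_prod.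
  by exists A1, C1, f1, g1.
Qed.

Lemma gp_zero Z : (forall z : Z, z = 0) -> gp Z.
Proof. by move=> /projective0/gp_projective. Qed.

Lemma gp_iso X Y : mod_iso X Y -> gp X -> gp Y.
Proof.
move=> [f [g [fK gK]]] gX; have [Z Z0] := zero_module_exists R.
have [_ s] := iso_exact fK gK Z0.
exact: (gp_extension s gX (gp_zero Z0)).
Qed.

Lemma gp_prod X Y : gp X -> gp Y -> gp (X * Y)%type.
Proof. exact: gp_extension (split_exact X Y). Qed.

(** [gp_coind] applies to the modules with a projective complement: an embedding of [Y * P'] in a
    projective restricts to [Y], and the new cokernel is an extension of the old one by [P']; dually
    for presentations. *)
Lemma gp_cancel X P : projective P -> gp (X * P)%type -> gp X.
Proof.
move=> projP gXP; have [Z Z0] := zero_module_exists R.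
pose S Y := exists2 P, projective P & gp (Y * P)%type.
have gpS Y : gp Y -> S Y.
  by move=> gY; exists Z; [exact: projective0|apply/gp_prod/gp_zero].
apply: (gp_coind (S := S)); last by exists P.
- move=> Y Q [P' projP' gY] projQ.
  by apply: (E1_retract_l (s := linl Y P') (r := lfst Y P')) (gp_E1 gY projQ).
- move=> Y [P' projP' gY].
  have [Q [D [i [p [projQ s gD]]]]] := gp_embedding gY.
  have [K [q [j [p' [t t']]]]] := exact_comp_mono (split_exact Y P') s.
  exists Q, K, (lcomp i (linl Y P')), q; split=> //; apply: gpS.
  exact: (gp_extension t' (gp_projective projP') gD).
- move=> Y [P' projP' gY].
  have [Q [D [i [p [projQ s gD]]]]] := gp_presentation gY.
  have [K [j [l [p' [t t' _ _]]]]] := exact_comp_epi s (split_exact_l Y P').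
  exists Q, K, j, (lcomp (lfst Y P') p); split=> //; apply: gpS.
  exact: (gp_extension t' gD (gp_projective projP')).
Qed.

(** The pullback along a projective presentation of [C] is an extension of [B] by [L], and is also
    [A] plus a projective. *)
Lemma gp_kernel A B C (f : {linear A -> B}) (g : {linear B -> C}) :
  short_exact f g -> gp B -> gp C -> gp A.
Proof.
move=> s gB gC; have [P [L [i [p [projP t gL]]]]] := gp_presentation gC.
have [E [f' [g' [i' [p' [s' t']]]]]] := pullback_exact s t.
apply: (gp_cancel projP); have gE := gp_extension t' gL gB.
exact: gp_iso (mod_iso_sym (E1_iso (E1_projective (Y := A) projP) s')) gE.
Qed.

(** * Shifts in both directions *)

Lemma shift_gp A B : shift A B -> gp A /\ gp B.
Proof. by move=> [P [a [b [_ []]]]]. Qed.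

Lemma shift_exact A B P (a : {linear A -> P}) (b : {linear P -> B}) :
  projective P -> gp A -> gp B -> short_exact a b -> shift A B.
Proof.
by move=> projP gA gB s; exists P, a, b; split=> //; split=> //;
   apply: gp_projective.
Qed.

Fact susp_exists A : exists B, gp A -> shift A B.
Proof.
case: (pselect (gp A)) => [gA|?]; last by exists A.
have [P [B [i [p [projP s gB]]]]] := gp_embedding gA.
by exists B => _; apply: shift_exact s.
Qed.

Fact loop_exists A : exists B, gp A -> shift B A.
Proof.
case: (pselect (gp A)) => [gA|?]; last by exists A.
have [P [B [i [p [projP s gB]]]]] := gp_presentation gA.
by exists B => _; apply: shift_exact s.
Qed.

(** Existence was stated with the hypothesis under the quantifier, which makes [susp] and [loop]
    total; outside GP(R) their values are arbitrary. *)
Definition susp A : lmodType R := sval (cid (susp_exists A)).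
Definition loop A : lmodType R := sval (cid (loop_exists A)).

Lemma shift_susp A : gp A -> shift A (susp A).
Proof. exact: svalP (cid (susp_exists A)). Qed.
Lemma shift_loop A : gp A -> shift (loop A) A.
Proof. exact: svalP (cid (loop_exists A)). Qed.
Lemma gp_susp A : gp A -> gp (susp A).
Proof. by move=> /shift_susp/shift_gp[]. Qed.
Lemma gp_loop A : gp A -> gp (loop A).
Proof. by move=> /shift_loop/shift_gp[]. Qed.
Lemma gp_iter_susp n A : gp A -> gp (iter n susp A).
Proof. by move=> gA; elim: n => //= n; apply: gp_susp. Qed.
Lemma gp_iter_loop n A : gp A -> gp (iter n loop A).
Proof. by move=> gA; elim: n => //= n; apply: gp_loop. Qed.

Lemma shiftn_susp n A : gp A -> shiftn n A (iter n susp A).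
Proof.
elim: n A => [//|n IHn] A gA; exists (susp A); first exact: shift_susp.
by rewrite iterSr; apply/IHn/gp_susp.
Qed.

(** Both sides express Ext^2(X, Y) = 0, computed from a syzygy of [X] or from a cosyzygy of [Y]. *)
Lemma E1_shift K X Y Y1 : shift K X -> shift Y Y1 -> E1 K Y <-> E1 X Y1.
Proof.
move=> [P [i [p [projP [gK gP gX s]]]]] [Q [a [b [projQ [gY gQ gY1 t]]]]].
split=> [e|e]; first exact: (E1_cone s projP t (gp_E1 gX projQ) e).
have [P' [L [j [q [projP' u gL]]]]] := gp_presentation gK.
apply: (E1_presentation u projP') => h; case: (t) => ai ab bs.
(* The map [h] is pushed into [Q]; what this induces on [K] is extended to [P], lifted to [Q] and
   subtracted, after which the values lie in [Y]. *)
have [k kE] := gp_E1 gK projQ u (lcomp a h).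
case: (u) => _ jq qs.
have [x /jq[y <-]|k1 k1E] := desc_surj (f := lcomp b k) qs.
  by rewrite /= kE (exact0 t).
have [k2 k2E] := e _ _ _ _ s k1; have [m mE] := projP _ _ b k2 bs.
have [x|r rE] := lift_inj (f := lsub k (lcomp m (lcomp i q))) ai.
  by apply/ab; rewrite /= linearB mE k2E k1E subrr.
exists r => x; apply: ai.
by rewrite rE /= (exact0 u) !linear0 addr0 kE.
Qed.

(** A map to [Y1] factors through a projective exactly when it lifts to [Q], and the obstruction
    lies in Ext^1(X, Y). This is the bridge between the stable category and Ext. *)
Lemma stably_zeroP X Y Y1 : gp X -> shift Y Y1 ->
  (forall f : {linear X -> Y1}, stably_zero f) <-> E1 X Y.
Proof.
move=> gX [Q [a [b [projQ [gY gQ gY1 t]]]]]; case: (t) => ai ab bs.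
split=> [sz A B f g s h|e f]; last first.
  have [v vE] := E1_lift f t e.
  by exists Q; split=> //; exists v, b => x; rewrite vE.
have [k kE] := gp_E1 gX projQ s (lcomp a h); case: (s) => _ fg gs.
have [x /fg[y <-]|k1 k1E] := desc_surj (f := lcomp b k) gs.
  by rewrite /= kE (exact0 t).
have [Q' [projQ' [c [d cd]]]] := sz k1; have [m mE] := projQ' _ _ b d bs.
have [x|r rE] := lift_inj (f := lsub k (lcomp m (lcomp c g))) ai.
  by apply/ab; rewrite /= linearB mE -cd k1E subrr.
exists r => x; apply: ai.
by rewrite rE /= (exact0 s) !linear0 addr0 kE.
Qed.

(** * Comparison with Ext computed from resolutions *)

Lemma proj_resolution_exists X : gp X ->
  exists (P : nat -> lmodType R) (d : forall n, {linear P n.+1 -> P n})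
    (e : {linear P 0 -> X}), proj_resolution d e.
Proof.
move=> gX.
have down_ex (x : {X | gp X}) : exists x' : {X | gp X}, exists P
    (i : {linear sval x' -> P}) (p : {linear P -> sval x}),
    projective P /\ short_exact i p.
  have [P [X' [i [p [projP s gX']]]]] := gp_presentation (svalP x).
  by exists (exist _ X' gX'), P, i, p.
have [down downE] := choice down_ex.
pose Xs n := iter n down (exist _ X gX).
have step n : {P : lmodType R & {i : {linear sval (Xs n.+1) -> P} &
    {p : {linear P -> sval (Xs n)} | projective P /\ short_exact i p}}}.
  have /cid[P /cid[i /cid[p H]]] := downE (Xs n).
  by exists P, i, p.
pose P n := tag (step n).
pose i n : {linear sval (Xs n.+1) -> P n} := tag (tagged (step n)).
pose p n : {linear P n -> sval (Xs n)} := sval (tagged (tagged (step n))).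
have projP n : projective (P n) := (svalP (tagged (tagged (step n)))).1.
have ex n : short_exact (i n) (p n) := (svalP (tagged (tagged (step n)))).2.
have dE n : exact_at (lcomp (i n) (p n.+1)) (p n).
  move=> y; case: (ex n) => _ ip _; case: (ex n.+1) => _ _ ps.
  split=> [/ip[x <-]|[x <-]]; last exact: exact0 (ex n) _.
  by have [z <-] := ps x; exists z.
exists P, (fun n => lcomp (i n) (p n.+1)), (p 0%N); split=> //.
  by case: (ex 0%N).
move=> n y; rewrite -dE /=; split=> [|->]; last by rewrite linear0.
by case: (ex n) => ii _ _ /eqP; rewrite -(linear0 (i n)) => /eqP/ii.
Qed.

Lemma resolution_Ext i X Y (P : nat -> lmodType R)
    (d : forall n, {linear P n.+1 -> P n}) (e : {linear P 0 -> X}) :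
  gp X -> gp Y -> proj_resolution d e ->
  (forall f : {linear P i.+1 -> Y}, cocycle d f -> coboundary d f) <->
  E1 X (iter i susp Y).
Proof.
move=> + gY; elim: i X P d e => [|n IHn] X P d e gX [projP es de dd].
(* Shared by both cases of the induction: the first syzygy [L] of [X] is covered by [P 1] through
   [p]. *)
all: have [L [i [ii iE]]] := kernel_exists e.
all: have s : short_exact i e by split=> // y; apply: iE.
all: have gL : gp L by apply: (gp_kernel s) => //; apply: gp_projective.
all: have [x|p pE] := lift_inj (f := d 0%N) ii;
  first by apply/iE/de; exists x.
all: have ps : surj p by move=> x; have /de[y yE] := exact0 s x;
  exists y; apply: ii; rewrite pE.
all: have dp : exact_at (d 1%N) p by move=> y; rewrite -dd -pE;
  split=> [->|/eqP]; [rewrite linear0|rewrite -(linear0 i) => /eqP/ii].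
  split=> [H|H f fd].
    apply: (E1_presentation s (projP _)) => h.
    have [|h' h'E] := H (lcomp h p).
      by move=> x; rewrite /= ((dp _).2 _) ?linear0 //; exists x.
    by exists h' => x; have [y <-] := ps x; rewrite pE -h'E.
  have [x /dp[y <-]|h hE] := desc_surj (f := f) ps; first exact: fd.
  have [h' h'E] := H _ _ _ _ s h.
  by exists h' => x; rewrite -pE h'E hE.
(* Dropping [P 0] leaves a resolution of [L], and [E1_shift] trades the syzygy for one more
   suspension of [Y]. *)
have res : proj_resolution (P := fun n => P n.+1) (fun n => d n.+1) p by split.
rewrite -(E1_shift (K := L) (Y := iter n susp Y)).
- exact: (IHn _ _ _ _ gL res).
- exact: (shift_exact (projP _) gL gX s).
- exact/shift_susp/gp_iter_susp.
Qed.

Lemma Ext_zeroP i X Y : gp X -> gp Y ->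
  Ext_zero i.+1 X Y <-> E1 X (iter i susp Y).
Proof.
move=> gX gY; have [P [d [e r]]] := proj_resolution_exists gX.
rewrite -(resolution_Ext i gX gY r).
split=> [H f|/(resolution_Ext i gX gY r) H].
  exact: H r _.
by move=> P' d' e' r'; apply/(resolution_Ext i gX gY r').
Qed.

Lemma E1_loop i X Y : gp X -> gp Y ->
  E1 (iter i loop X) Y <-> E1 X (iter i susp Y).
Proof.
elim: i Y => [//|i IHi] Y gX gY.
rewrite (iterSr i susp) -IHi //=; last exact: gp_susp.
by apply: E1_shift; [exact/shift_loop/gp_iter_loop|exact: shift_susp].
Qed.

End FrobeniusStructure.
Arguments susp {R}.
Arguments loop {R}.

(** * Extension-closed classes and thick subcategories *)

Section ExtensionClasses.
Variable R : pzRingType.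
Implicit Types (A B C E K L P Q X Y Z : lmodType R) (D : lmodType R -> Prop).
Notation gp := (@gorenstein_projective R).

(** These closure properties pass to preimages under [susp] and [loop], and make membership
    independent of the chosen shifts. Closure under summands is kept apart because it can require a
    separate argument. *)
Definition ext_class D : Prop :=
  [/\ forall P, projective P -> D P,
      forall A B C (f : {linear A -> B}) (g : {linear B -> C}),
        conflation f g -> D A -> D C -> D B
    & forall X P, gp X -> projective P -> D (X * P)%type -> D X].

Definition has_summands D : Prop :=
  forall X Z, gp X -> gp Z -> D (X * Z)%type -> D X.

Lemma conflation_ext A B C (f : {linear A -> B}) (g : {linear B -> C}) :
  short_exact f g -> gp A -> gp C -> conflation f g.
Proof. by move=> s gA gC; split=> //; apply: gp_extension s gA gC. Qed.

Lemma split_conflation X Y :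
  gp X -> gp Y -> conflation (linl X Y) (lsnd X Y).
Proof. exact: conflation_ext (split_exact X Y). Qed.

Lemma shift_prod X X1 Z Z1 :
  shift X X1 -> shift Z Z1 -> shift (X * Z)%type (X1 * Z1)%type.
Proof.
move=> [P [a [b [projP [gX _ gX1 s]]]]] [Q [c [d [projQ [gZ _ gZ1 t]]]]].
apply: shift_exact (exact_prod s t); [exact: projective_prod|exact: gp_prod..].
Qed.

Lemma ext_class_iso D X Y :
  ext_class D -> gp X -> mod_iso X Y -> D X -> D Y.
Proof.
move=> [Dproj Dext _] gX [f [g [fK gK]]]; have [Z Z0] := zero_module_exists R.
have [_ s] := iso_exact fK gK Z0 => DX.
exact: Dext (conflation_ext s gX (gp_zero Z0)) DX (Dproj _ (projective0 Z0)).
Qed.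

Lemma ext_class_prod D X Y :
  ext_class D -> gp X -> gp Y -> D X -> D Y -> D (X * Y)%type.
Proof. by move=> [_ Dext _] gX gY; apply/Dext/split_conflation. Qed.

Lemma ext_class_swap D X Y :
  ext_class D -> gp X -> gp Y -> D (X * Y)%type -> D (Y * X)%type.
Proof.
move=> extD gX gY; apply: (ext_class_iso extD (gp_prod gX gY)).
exact: mod_iso_prodC.
Qed.

(** Rotation of a triangle: the pushout of [B] and [P] under [A] is an extension of [A1] by [B], and
    is [P] plus [C] because Ext^1(C, P) = 0. *)
Lemma ext_class_cone D A B C A1 (f : {linear A -> B}) (g : {linear B -> C}) :
  ext_class D -> conflation f g -> shift A A1 -> D B -> D A1 -> D C.
Proof.
move=> extD [gA gB gC s] [P [a [b [projP [_ gP gA1 t]]]]] DB DA1.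
have [E [f' [g' [u' [w' [s' t']]]]]] := pushout_exact s t.
have [_ Dext Dcancel] := extD.
have DE : D E by apply: Dext (conflation_ext t' gB gA1) DB DA1.
have gE := gp_extension t' gB gA1.
apply: (Dcancel _ _ gC projP); apply: ext_class_swap => //.
apply: (ext_class_iso extD gE) DE; apply/mod_iso_sym.
exact: E1_iso (gp_E1 gC projP) s'.
Qed.

Lemma ext_class_cocone D A B C K (f : {linear A -> B}) (g : {linear B -> C}) :
  ext_class D -> conflation f g -> shift K C -> D B -> D K -> D A.
Proof.
move=> extD [gA gB gC s] [P [a [b [projP [gK gP _ t]]]]] DB DK.
have [E [f' [g' [u' [w' [s' t']]]]]] := pullback_exact s t.
have [_ Dext Dcancel] := extD.
have DE : D E by apply: Dext (conflation_ext t' gK gB) DK DB.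
have gE := gp_extension t' gK gB.
apply: (Dcancel _ _ gA projP); apply: (ext_class_iso extD gE) DE.
exact: mod_iso_sym (E1_iso (E1_projective (Y := A) projP) s').
Qed.

(** A form of Schanuel's lemma: rotating the second conflation involves only its projective middle
    term and [B]. *)
Lemma shift_unique D A B B' :
  ext_class D -> shift A B -> shift A B' -> D B -> D B'.
Proof.
move=> extD sB [P [a [b [projP conf]]]] DB; have [Dproj _ _] := extD.
exact: ext_class_cone extD conf sB (Dproj _ projP) DB.
Qed.

Lemma loop_unique D A A' B :
  ext_class D -> shift A B -> shift A' B -> D A -> D A'.
Proof.
move=> extD sB [P [a [b [projP conf]]]] DB; have [Dproj _ _] := extD.
exact: ext_class_cocone extD conf sB (Dproj _ projP) DB.
Qed.

(** By the horseshoe lemma suspension carries conflations to conflations, and the zero module is a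
    suspension of any projective; [shift_unique] absorbs the choices. *)
Lemma ext_class_susp D : ext_class D -> ext_class (fun X => D (susp X)).
Proof.
move=> extD; have [Dproj Dext Dcancel] := extD; split.
- move=> P projP; have [Z Z0] := zero_module_exists R.
  have gP := gp_projective projP.
  apply: (shift_unique extD) (shift_susp gP) (Dproj _ (projective0 Z0)).
  exact: shift_exact projP gP (gp_zero Z0) (id_exact P Z0).2.
- move=> A B C f g [gA gB gC s] DA DC.
  have [PA [a [a' [projA [_ _ gA1 ea]]]]] := shift_susp gA.
  have [PC [c [c' [projC [_ _ gC1 ec]]]]] := shift_susp gC.
  have [u uf] := gp_E1 gC projA s a.
  have [B1 [b [b' [f1 [g1 [eb e1]]]]]] := horseshoe_mono s ea ec uf.
  apply: (shift_unique extD) (shift_susp gB) (Dext _ _ _ _ _ _ DA DC).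
    apply: shift_exact (projective_prod projA projC) gB _ eb.
    exact: gp_extension e1 gA1 gC1.
  exact: conflation_ext e1 gA1 gC1.
- move=> X P gX projP; have [Z Z0] := zero_module_exists R.
  have gP := gp_projective projP.
  have sP := shift_exact projP gP (gp_zero Z0) (id_exact P Z0).2.
  move=> /(shift_unique extD (shift_susp (gp_prod gX gP))).
  move=> /(_ _ (shift_prod (shift_susp gX) sP)).
  exact: Dcancel (gp_susp gX) (projective0 Z0).
Qed.

Lemma ext_class_loop D : ext_class D -> ext_class (fun X => D (loop X)).
Proof.
move=> extD; have [Dproj Dext Dcancel] := extD; split.
- move=> P projP; have [Z Z0] := zero_module_exists R.
  have gP := gp_projective projP.
  apply: (loop_unique extD) (shift_loop gP) (Dproj _ (projective0 Z0)).
  exact: shift_exact projP (gp_zero Z0) gP (id_exact P Z0).1.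
- move=> A B C f g [gA gB gC s] DA DC.
  have [PA [a [a' [projA [gA1 _ _ ea]]]]] := shift_loop gA.
  have [PC [c [c' [projC [gC1 _ _ ec]]]]] := shift_loop gC.
  have [_ _ gs] := s; have [v gv] := projC _ _ g c' gs.
  have [B1 [b [b' [f1 [g1 [eb e1]]]]]] := horseshoe_epi s ea ec gv.
  apply: (loop_unique extD) (shift_loop gB) (Dext _ _ _ _ _ _ DA DC).
    apply: shift_exact (projective_prod projA projC) _ gB eb.
    exact: gp_extension e1 gA1 gC1.
  exact: conflation_ext e1 gA1 gC1.
- move=> X P gX projP; have [Z Z0] := zero_module_exists R.
  have gP := gp_projective projP.
  have sP := shift_exact projP (gp_zero Z0) gP (id_exact P Z0).1.
  move=> /(loop_unique extD (shift_loop (gp_prod gX gP))).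
  move=> /(_ _ (shift_prod (shift_loop gX) sP)).
  exact: Dcancel (gp_loop gX) (projective0 Z0).
Qed.

Lemma ext_class_iter_susp D n :
  ext_class D -> ext_class (fun X => D (iter n susp X)).
Proof. by elim: n D => [//|n IHn] D /ext_class_susp/IHn. Qed.

Lemma ext_class_iter_loop D n :
  ext_class D -> ext_class (fun X => D (iter n loop X)).
Proof. by elim: n D => [//|n IHn] D /ext_class_loop/IHn. Qed.

Lemma has_summands_susp D : ext_class D ->
  has_summands D -> has_summands (fun X => D (susp X)).
Proof.
move=> extD sumD X Z gX gZ /(shift_unique extD (shift_susp (gp_prod gX gZ))).
move=> /(_ _ (shift_prod (shift_susp gX) (shift_susp gZ))).
exact: sumD (gp_susp gX) (gp_susp gZ).
Qed.

Lemma has_summands_loop D : ext_class D ->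
  has_summands D -> has_summands (fun X => D (loop X)).
Proof.
move=> extD sumD X Z gX gZ /(loop_unique extD (shift_loop (gp_prod gX gZ))).
move=> /(_ _ (shift_prod (shift_loop gX) (shift_loop gZ))).
exact: sumD (gp_loop gX) (gp_loop gZ).
Qed.

Lemma has_summands_iter_susp D n : ext_class D ->
  has_summands D -> has_summands (fun X => D (iter n susp X)).
Proof.
elim: n D => [//|n IHn] D extD sumD.
exact: IHn (ext_class_susp extD) (has_summands_susp extD sumD).
Qed.

Lemma has_summands_iter_loop D n : ext_class D ->
  has_summands D -> has_summands (fun X => D (iter n loop X)).
Proof.
elim: n D => [//|n IHn] D extD sumD.
exact: IHn (ext_class_loop extD) (has_summands_loop extD sumD).
Qed.

Lemma ext_class_all I (T : I -> Prop) (F : I -> lmodType R -> Prop) :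
  (forall i, T i -> ext_class (F i)) ->
  ext_class (fun X => forall i, T i -> F i X).
Proof.
move=> extF.
split=> [P projP i Ti|A B C f g conf FA FC i Ti|X P gX projP H i Ti].
- by have [+ _ _] := extF i Ti; apply.
- by have [_ + _] := extF i Ti; apply; [exact: conf|exact: FA|exact: FC].
- by have [_ _] := extF i Ti; apply; [exact: gX|exact: projP|exact: H].
Qed.

Lemma has_summands_all I (T : I -> Prop) (F : I -> lmodType R -> Prop) :
  (forall i, T i -> has_summands (F i)) ->
  has_summands (fun X => forall i, T i -> F i X).
Proof. by move=> sumF X Z gX gZ H i Ti; apply: sumF (H i Ti). Qed.

Lemma ext_class_and D D' :
  ext_class D -> ext_class D' -> ext_class (fun X => D X /\ D' X).
Proof.
move=> [p e c] [p' e' c']; split=> [P projP|A B C f g conf [DA DA'] [DC DC']|].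
- by split; [apply: p|apply: p'].
- by split; [apply: e conf DA DC|apply: e' conf DA' DC'].
- by move=> X P gX projP [DX DX']; split; [apply: c DX|apply: c' DX'].
Qed.

Lemma has_summands_and D D' :
  has_summands D -> has_summands D' -> has_summands (fun X => D X /\ D' X).
Proof.
by move=> s s' X Z gX gZ [DX DX']; split; [apply: s DX|apply: s' DX'].
Qed.

Lemma ext_class_union (F : nat -> lmodType R -> Prop) :
  (forall n, ext_class (F n)) ->
  (forall n X, gp X -> F n X -> F n.+1 X) ->
  ext_class (fun X => exists n, F n X).
Proof.
move=> extF mono; have monoD n m X : gp X -> F n X -> F (m + n)%N X.
  by move=> gX FX; elim: m => // m; apply: mono.
split=> [P projP|A B C f g conf [n FA] [m FC]|X P gX projP [n FX]].
- by exists 0%N; have [+ _ _] := extF 0%N; apply.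
- have [gA _ gC _] := conf; exists (n + m)%N.
  have [_ + _] := extF (n + m)%N; apply; first exact: conf.
    by rewrite addnC; apply: monoD.
  exact: monoD.
- by exists n; have [_ _] := extF n; apply; [exact: gX|exact: projP|].
Qed.

Lemma has_summands_union (F : nat -> lmodType R -> Prop) :
  (forall n, has_summands (F n)) -> has_summands (fun X => exists n, F n X).
Proof. by move=> sumF X Z gX gZ [n FX]; exists n; apply: sumF FX. Qed.

(** * Classes cut out by Ext^1, and stable isomorphism *)

Lemma ext_class_gp : ext_class gp.
Proof.
split=> [P|A B C f g [] //|X P gX _ _ //]; exact: gp_projective.
Qed.

Lemma ext_class_E1r X : gp X -> ext_class (E1 X).
Proof.
move=> gX; split=> [Q|A B C f g [gA gB gC s]|Y P gY projP].
- exact: gp_E1.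
- have [P [L [i [p [projP t gL]]]]] := gp_presentation gX.
  exact: E1_ext_r t projP s.
- exact: (E1_retract_r (s := linl Y P) (r := lfst Y P)).
Qed.

Lemma has_summands_E1r X : has_summands (E1 X).
Proof.
by move=> Y Z _ _; apply: (E1_retract_r (s := linl Y Z) (r := lfst Y Z)).
Qed.

Lemma ext_class_E1l Y : ext_class (fun X => E1 X Y).
Proof.
split=> [Q|A B C f g [gA gB gC s]|X P gX projP].
- exact: E1_projective.
- exact: E1_ext_l s.
- exact: (E1_retract_l (s := linl X P) (r := lfst X P)).
Qed.

Lemma has_summands_E1l Y : has_summands (fun X => E1 X Y).
Proof.
by move=> X Z _ _; apply: (E1_retract_l (s := linl X Z) (r := lfst X Z)).
Qed.

(** By [gp_kernel] the kernel of the retraction is Gorenstein projective, so a retract is a direct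
    summand in GP(R). *)
Lemma ext_class_retract D X Y (s : {linear Y -> X}) (r : {linear X -> Y}) :
  ext_class D -> has_summands D -> gp X -> gp Y ->
  (forall y, r (s y) = y) -> D X -> D Y.
Proof.
move=> extD sumD gX gY rs DX; have [K [i [ii iE]]] := kernel_exists r.
have e : short_exact i r by split=> // y; exists (s y).
have gK := gp_kernel e gX gY.
have [q qi] := section_retraction e rs.
have [_ [_ _ iso]] := retraction_iso e qi.
apply: (sumD _ _ gY gK); apply: ext_class_swap => //.
exact: ext_class_iso (mod_iso_sym iso) DX.
Qed.

Lemma subcategory_mod_iso D : ext_class D -> has_summands D ->
  (forall X, D X -> gp X) -> subcategory (@mod_iso R) D.
Proof.
move=> extD sumD Dgp; have [Dproj _ _] := extD; split; first split=> //.
- have [Z Z0] := zero_module_exists R; exists Z => //.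
  exact/Dproj/projective0.
- by move=> X Y DX DY; apply: ext_class_prod => //; apply: Dgp.
- by move=> X Y gY iso DX; exact: (ext_class_iso extD (Dgp _ DX) iso DX).
- move=> X Y Z gX gZ iso DY; apply: (sumD _ _ gX gZ).
  exact: (ext_class_iso extD (Dgp _ DY) (mod_iso_sym iso) DY).
Qed.

(** If [f \o g] differs from the identity of [Y] by a map through [Q], then [Y] is a retract of
    [X * Q]. *)
Lemma ext_class_stable_iso D X Y : ext_class D -> has_summands D ->
  gp X -> gp Y -> stable_iso X Y -> D X -> D Y.
Proof.
move=> extD sumD gX gY [f [g [_ [Q [projQ [a [b ab]]]]]]] DX.
have [Dproj _ _] := extD; have gQ := gp_projective projQ.
apply: (ext_class_retract (X := (X * Q)%type) (s := lpair g a)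
  (r := lcopair f (lopp b)) extD sumD) => //; first exact: gp_prod.
  move=> y /=; have := ab y; rewrite /= => <-.
  by rewrite opprB addrC subrK.
by apply: ext_class_prod => //; apply: Dproj.
Qed.

Lemma stable_iso_sym X Y : stable_iso X Y -> stable_iso Y X.
Proof. by move=> [f [g [gf fg]]]; exists g, f. Qed.

Lemma subcategory_stable_iso D : ext_class D -> has_summands D ->
  (forall X, D X -> gp X) -> subcategory (@stable_iso R) D.
Proof.
move=> extD sumD Dgp.
have [[_ D0 Dprod _] _] := subcategory_mod_iso extD sumD Dgp.
split; first split=> //.
  move=> X Y gY iso DX.
  exact: (ext_class_stable_iso extD sumD (Dgp _ DX) gY iso DX).
move=> X Y Z gX gZ iso DY; apply: (sumD _ _ gX gZ).
apply: (ext_class_stable_iso extD sumD (Dgp _ DY) _ (stable_iso_sym iso) DY).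
exact: gp_prod.
Qed.

(** Up to stable isomorphism a distinguished triangle comes from a conflation Y -> Z -> X[1], so
    extension closure and shift invariance give closure under cones. *)
Lemma ext_class_thick D : ext_class D -> has_summands D ->
  (forall X, D X -> gp X) -> (forall X, gp X -> D X <-> D (susp X)) ->
  thick_subcat D.
Proof.
move=> extD sumD Dgp DS.
have [addD sumsD] := subcategory_stable_iso extD sumD Dgp.
split=> //; split=> //.
  move=> A B sAB; have [gA gB] := shift_gp sAB; rewrite DS //.
  split; first exact: shift_unique extD (shift_susp gA) sAB.
  exact: shift_unique extD sAB (shift_susp gA).
move=> t [t' [conf _] [f [g [h [f1 [[isf isg ish _] _]]]]]] DX DY.
have [gX _ gX1 _] := tab_conf t'; have [_ Dext _] := extD.
have back X Y (k : {linear X -> Y}) : gp X -> gp Y -> is_stable_iso k ->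
    D Y -> D X.
  move=> gX' gY' ik; apply: ext_class_stable_iso => //.
  by apply: stable_iso_sym; exists k.
have DX' := back _ _ f gX (Dgp _ DX) isf DX.
have DY' := back _ _ g (tY_gp t') (Dgp _ DY) isg DY.
have DZ' : D (tZ t').
  apply: Dext conf DY' _.
  apply: shift_unique extD (shift_susp gX) _ ((DS _ gX).1 DX').
  by exists (tP t'), (ta t'), (tb t'); split; [exact: tP_proj|exact: tab_conf].
by apply: ext_class_stable_iso DZ' => //; [exact: tZ_gp..|exists h].
Qed.

(** * From thick subcategories back to extension-closed classes *)

Lemma stable_eq_ext A B (f g : A -> B) : (forall x, f x = g x) -> stable_eq f g.
Proof.
move=> fg; have [Z Z0] := zero_module_exists R.
exists Z; split; first exact: projective0.
by exists (lzero A Z), (lzero Z B) => x; rewrite fg subrr.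
Qed.

Lemma mod_iso_stable X Y : mod_iso X Y -> stable_iso X Y.
Proof.
move=> [f [g [fK gK]]]; exists f, g.
by split; apply: stable_eq_ext => x; [apply: fK|apply: gK].
Qed.

Lemma lid_stable_iso A : is_stable_iso (lid A).
Proof. by exists (lid A); split; apply: stable_eq_ext. Qed.

Lemma thick_conflation D A B C (f : {linear A -> B}) (g : {linear B -> C}) :
  triangulated_subcat D -> conflation f g -> D A -> D C -> D B.
Proof.
move=> [_ Dshift Dtri] conf DA DC; case: (conf) => gA gB gC s.
have [P [L [i [p [projP t gL]]]]] := gp_presentation gC.
have [fi fg gs] := s; have [q qE] := projP _ _ g p gs.
have [x|u uE] := lift_inj (f := lcomp q i) fi.
  by apply/fg; rewrite /= qE (exact0 t).
have tconf : conflation i p by split=> //; exact: gp_projective.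
(* The conflation is the end of the standard triangle C[-1] -> A -> B -> C, whose third vertex is
   [B]. *)
pose T := Triangle u f g projP gA gB tconf.
have DL : D L by apply/(Dshift L C) => //; exists P, i, p.
apply: (Dtri T) => //; exists T; first by split=> //; exists q; split.
exists (lid _), (lid _), (lid _), (lid _); split; split.
- exact: lid_stable_iso.
- exact: lid_stable_iso.
- exact: lid_stable_iso.
- by exists (lid _).
- exact: stable_eq_ext.
- exact: stable_eq_ext.
- exact: stable_eq_ext.
Qed.

Lemma thick_ext_class D : thick_subcat D ->
  [/\ ext_class D, has_summands D & forall X, gp X -> D X -> D (susp X)].
Proof.
move=> [triD sumD]; have [[Dgp [Z DZ Z0] Dprod Diso] Dshift _] := triD.
have sumD' : has_summands D.
  move=> X Y gX gY.
  exact: (sumD X _ Y gX gY (mod_iso_stable (mod_iso_refl _))).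
have Dproj P : projective P -> D P.
  move=> projP; apply: (Diso Z) => //; first exact: gp_projective.
  exists (lzero Z P), (lzero P Z); split.
    by apply: stable_eq_ext => z; rewrite (Z0 z) (Z0 (_ _)).
  exists P; split=> //; exists (lid P), (lopp (lid P)) => x.
  by rewrite /= sub0r.
split=> //; first split=> //.
- by move=> A B C f g; apply: thick_conflation.
- by move=> X P gX /gp_projective gP; apply: sumD'.
- by move=> X gX /(Dshift _ _ (shift_susp gX)).
Qed.

Lemma thick_loop D : thick_subcat D -> forall X, gp X -> D X -> D (loop X).
Proof. by move=> [[_ Dshift _] _] X gX /(Dshift _ _ (shift_loop gX)). Qed.

End ExtensionClasses.

(** * Orthogonals *)

Section Orthogonals.
Variable R : pzRingType.
Implicit Types (A B C E K L P Q X Y Z : lmodType R)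
  (D H M S : lmodType R -> Prop).
Notation gp := (@gorenstein_projective R).

Lemma right_perpP M Y : (forall X, M X -> gp X) ->
  right_perp M Y <-> gp Y /\ forall X, M X -> forall i, E1 X (iter i susp Y).
Proof.
move=> Mgp; split=> -[gY perp]; split=> //.
  by move=> X MX i; apply/Ext_zeroP => //; [apply: Mgp|apply: perp].
by move=> [//|i] _ X MX; apply/Ext_zeroP => //; [apply: Mgp|apply: perp].
Qed.

Lemma left_perpP H X : (forall Y, H Y -> gp Y) ->
  left_perp H X <-> gp X /\ forall Y, H Y -> forall i, E1 X (iter i susp Y).
Proof.
move=> Hgp; split=> -[gX perp]; split=> //.
  by move=> Y HY i; apply/Ext_zeroP => //; [apply: Hgp|apply: perp].
by move=> [//|i] _ Y HY; apply/Ext_zeroP => //; [apply: Hgp|apply: perp].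
Qed.

Lemma E1_susp_gp X Y i :
  gp X -> gp Y -> E1 X (iter i.+1 susp Y) <-> E1 (loop X) (iter i susp Y).
Proof.
move=> gX gY; rewrite -(E1_loop i.+1 gX gY) -(E1_loop i (gp_loop gX) gY).
by rewrite iterSr.
Qed.

Section RightPerp.
Variable M : lmodType R -> Prop.
Hypothesis Mgp : forall X, M X -> gp X.

Lemma right_perp_ext_class :
  ext_class (right_perp M) /\ has_summands (right_perp M).
Proof.
(* The trivial guard [True] gives the orthogonal the shape of an intersection as in
   [ext_class_all]. *)
have -> : right_perp M =
    fun Y => gp Y /\ forall X, M X -> forall i, True -> E1 X (iter i susp Y).
  apply/funext => Y; apply/propext; rewrite right_perpP //.
  by split=> -[gY perp]; split=> // X MX i; auto.
have c X : M X ->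
    ext_class (fun Y => forall i, True -> E1 X (iter i susp Y)) /\
    has_summands (fun Y => forall i, True -> E1 X (iter i susp Y)).
  move=> MX; have cX := ext_class_E1r (Mgp MX); split.
    apply: ext_class_all => i _; exact: ext_class_iter_susp.
  apply: has_summands_all => i _; apply: has_summands_iter_susp => //.
  exact: has_summands_E1r.
split.
  apply: ext_class_and; first exact: ext_class_gp.
  by apply: ext_class_all => X /c[].
apply: has_summands_and => //.
by apply: has_summands_all => X /c[].
Qed.

Lemma right_perp_susp Y : right_perp M Y -> right_perp M (susp Y).
Proof.
rewrite !right_perpP // => -[gY perp]; split; first exact: gp_susp.
by move=> X MX i; rewrite -iterSr; apply: perp.
Qed.

End RightPerp.

Section LeftPerp.
Variable H : lmodType R -> Prop.
Hypothesis Hgp : forall X, H X -> gp X.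

Lemma left_perp_ext_class :
  ext_class (left_perp H) /\ has_summands (left_perp H).
Proof.
have -> : left_perp H =
    fun X => gp X /\ forall Y, H Y -> forall i, True -> E1 X (iter i susp Y).
  apply/funext => X; apply/propext; rewrite left_perpP //.
  by split=> -[gX perp]; split=> // Y HY i; auto.
split.
  apply: ext_class_and; first exact: ext_class_gp.
  apply: ext_class_all => Y _; apply: ext_class_all => i _.
  exact: ext_class_E1l.
apply: has_summands_and => //.
apply: has_summands_all => Y _; apply: has_summands_all => i _.
exact: has_summands_E1l.
Qed.

Lemma left_perp_loop X : left_perp H X -> left_perp H (loop X).
Proof.
rewrite !left_perpP // => -[gX perp]; split; first exact: gp_loop.
by move=> Y HY i; apply/E1_susp_gp; [|exact: Hgp|exact: perp].
Qed.

End LeftPerp.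

(* A Frobenius version of the octahedral axiom: a conflation ending in [C] is
   extended along [C -> X -> K] as soon as Ext^2(K, Y) = 0. *)
Lemma conflation_along A B C X K (f : {linear A -> B}) (g : {linear B -> C})
    (u : {linear C -> X}) (w : {linear X -> K}) :
  conflation f g -> conflation u w -> E1 K (susp A) ->
  exists E (f' : {linear A -> E}) (g' : {linear E -> X})
    (u' : {linear B -> E}) (w' : {linear E -> K}),
  conflation f' g' /\ conflation u' w'.
Proof.
move=> [gA gB gC s] [_ gX gK t] ext2.
have [P [L [l [p [projP e gL]]]]] := gp_presentation gX.
(* [P'] is the preimage of [C] in [P] and represents K[-1], so Ext^2(K, A) = 0 lets [p'] lift to
   [B]. The pushout of [P] along this lift is the required [E]. *)
have [P' [j [l' [p' [ej el jl up]]]]] := exact_comp_epi e t.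
have gP' := gp_extension el gL gC.
have extA : E1 P' A.
  exact: (E1_shift (shift_exact projP gP' gK ej) (shift_susp gA)).2 ext2.
have [v vE] := E1_lift p' s extA.
have [E [f1 [w' [u1 [s1 uj w1 surj1]]]]] := pushout_mono v ej.
have [| |g' g'E] := desc_surj (p := lcopair u1 f1)
    (f := lcopair p (lcomp u g)).
- by move=> y; have [a [b ->]] := surj1 y; exists (a, b).
- move=> [x b] /= /[dup] xb /(congr1 w'); case: (s1) => f1i f1w _.
  rewrite linearD w1 (exact0 s1) addr0 linear0; case: (ej) => ji jw _ /jw[z zx].
  have bE : b = - v z.
    apply: f1i; rewrite linearN -uj zx; apply/eqP.
    by rewrite -addr_eq0 addrC xb.
  by rewrite bE -zx !linearN vE up subrr.
have gu x : g' (u1 x) = p x by have := g'E (x, 0); rewrite /= !linear0 !addr0.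
have gf b : g' (f1 b) = u (g b).
  by have := g'E (0, b); rewrite /= !linear0 !add0r.
exists E, (lcomp f1 f), g', f1, w'; split; last exact: conflation_ext s1 gB gK.
apply: conflation_ext => //.
case: (s1) (s) (e) (t) (ej) => f1i f1w w's [fi fg gs].
move=> [li lp ps] [ui uw ws] [ji jw js]; split.
- by move=> x y /f1i/fi.
- move=> y; have [x [b ->]] := surj1 y.
  split=> [|[a <-]]; last by rewrite /= gf (exact0 s) linear0.
  rewrite linearD gu gf => xb.
  have /jw[z zx] : w (p x) = 0.
    by have := congr1 w xb; rewrite linearD (exact0 t) addr0 linear0.
  have /fg[a aE] : g (v z + b) = 0.
    by apply: ui; rewrite !linearD vE up zx xb linear0.
  by exists a; rewrite /= aE linearD -uj zx.
- by move=> x; have [z <-] := ps x; exists (u1 z).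
Qed.

Lemma iter_susp_loop D n X : ext_class D -> gp X ->
  D (iter n susp X) <-> D (iter n.+1 susp (loop X)).
Proof.
move=> extD gX; rewrite iterSr; have extDn := ext_class_iter_susp n extD.
have s1 := shift_loop gX; have s2 := shift_susp (gp_loop gX).
by split; [exact: (shift_unique extDn s1 s2)|exact: (shift_unique extDn s2 s1)].
Qed.

Lemma iter_loop_susp D n X : ext_class D -> gp X ->
  D (iter n loop X) <-> D (iter n.+1 loop (susp X)).
Proof.
move=> extD gX; rewrite iterSr; have extDn := ext_class_iter_loop n extD.
have s1 := shift_susp gX; have s2 := shift_loop (gp_susp gX).
by split; [exact: (loop_unique extDn s1 s2)|exact: (loop_unique extDn s2 s1)].
Qed.

End Orthogonals.

(** * From silting to coresolving subcategories *)

Section SiltingToCoresolving.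
Variable R : pzRingType.
Implicit Types (A B C E K L P Q X Y Z : lmodType R).
Notation gp := (@gorenstein_projective R).
Variable M : lmodType R -> Prop.
Hypothesis silting_M : silting_class M.

Let H := right_perp M.
Let V := left_perp H.

Let Mgp X : M X -> gp X.
Proof. by case: silting_M => -[[+ _ _ _] _] _ _; apply. Qed.

Let Hgp X : H X -> gp X.
Proof. by case. Qed.

Let Vgp X : V X -> gp X.
Proof. by case. Qed.

Lemma silting_E1 X Y i : M X -> M Y -> E1 X (iter i susp Y).
Proof.
move=> MX MY; have [gX gY] := (Mgp MX, Mgp MY).
apply/(stably_zeroP gX (shift_susp (gp_iter_susp i gY))).
case: silting_M => _ _ [_ hom _].
exact: (hom _ _ _ i.+1 _ MX MY (shiftn_susp i.+1 gY)).
Qed.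

Lemma silting_thick S : thick_subcat S -> (forall X, M X -> S X) ->
  forall X, gp X -> S X.
Proof.
case: silting_M => _ _ [_ _ gen] thickS MS X gX.
by have /gen[_] := gX; apply.
Qed.

Let extH : ext_class H := (right_perp_ext_class Mgp).1.
Let sumH : has_summands H := (right_perp_ext_class Mgp).2.
Let extV : ext_class V := (left_perp_ext_class Hgp).1.
Let sumV : has_summands V := (left_perp_ext_class Hgp).2.

Let H_susp X : H X -> H (susp X).
Proof. exact: right_perp_susp. Qed.

Let H_iter_susp n X : H X -> H (iter n susp X).
Proof. by move=> HX; elim: n => //= n; apply: H_susp. Qed.

Let V_loop X : V X -> V (loop X).
Proof. exact: left_perp_loop. Qed.

Let VE1 X Y i : V X -> H Y -> E1 X (iter i susp Y).
Proof. by move=> /(left_perpP _ Hgp)[_ VX] HY; apply: VX. Qed.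

Let MH X : M X -> H X.
Proof.
move=> MX; apply/right_perpP => //; split=> [|Y MY i]; first exact: Mgp.
exact: silting_E1.
Qed.

Let MV X : M X -> V X.
Proof.
move=> MX; apply/left_perpP => //; split=> [|Y HY i]; first exact: Mgp.
by have /(right_perpP _ Mgp)[_] := HY; apply.
Qed.

(** Conflations with both ends in [M] split, as Ext^1 vanishes on [M]. *)
Lemma silting_ext_class : ext_class M /\ has_summands M.
Proof.
have [[[_ _ Mprod Miso] Msum] Mproj _] := silting_M.
have Msum' : has_summands M.
  by move=> X Z gX gZ; exact: (Msum X _ Z gX gZ (mod_iso_refl _)).
split=> //; split=> // [A B C f g [gA gB gC s] MA MC|X P gX projP].
  apply: (Miso (A * C)%type) => //; last exact: Mprod.
  exact: (E1_iso (Y := A) (silting_E1 (i := 0%N) MC MA) s).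
exact/Msum'/gp_projective.
Qed.

(* The objects of M[-n] * ... * M[-1] * M, n >= 0, in the stable category. *)
Inductive coresolved : lmodType R -> Prop :=
| coresolved_base X : M X -> coresolved X
| coresolved_ext A B C (f : {linear A -> B}) (g : {linear B -> C}) :
    conflation f g -> coresolved A -> coresolved C -> coresolved B
| coresolved_loop K X : shift K X -> coresolved X -> coresolved K.

Lemma coresolved_left_perp X : coresolved X -> V X.
Proof.
elim=> {X} [X /MV //|A B C f g conf _ VA _ VC|K X sKX _ VX].
  by have [_ Vext _] := extV; apply: Vext conf VA VC.
apply: loop_unique extV _ sKX (V_loop VX); exact/shift_loop/Vgp.
Qed.

(** By induction on the construction: extensions use the horseshoe lemma, with Ext^1(C, A0) = 0;
    negative shifts use the projective of the conflation that defines them. *)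
Lemma coresolved_conflation X : coresolved X ->
  exists X0 X1 (f : {linear X -> X0}) (g : {linear X0 -> X1}),
  [/\ conflation f g, M X0 & V X1].
Proof.
have [Vproj Vext _] := extV; have [_ Mproj _] := silting_M.
elim=> {X} [X MX|A B C f g conf _ + VC|K X [P [f [g [projP conf]]]] cX _].
- have [Z Z0] := zero_module_exists R.
  exists X, Z, (lid X), (lzero X Z); split=> //.
    apply: conflation_ext (id_exact X Z0).2 _ _; first exact: Mgp.
    exact: gp_zero.
  exact/Vproj/projective0.
- move=> [A0 [A1 [a [a' [[gA gA0 gA1 ea] MA0 VA1]]]]].
  move=> [C0 [C1 [c [c' [[gC gC0 gC1 ec] MC0 VC1]]]]].
  have [_ gB _ s] := conf.
  have [u uf] := VE1 (i := 0%N) (coresolved_left_perp VC) (MH MA0) s a.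
  have [B1 [b [b' [f' [g' [eb s']]]]]] := horseshoe_mono s ea ec uf.
  have [extM _] := silting_ext_class.
  exists (A0 * C0)%type, B1, b, b'; split.
  + exact: conflation_ext eb gB (gp_extension s' gA1 gC1).
  + exact: ext_class_prod.
  + exact: Vext (conflation_ext s' gA1 gC1) VA1 VC1.
- by exists P, X, f, g; split=> //; [exact: Mproj|exact: coresolved_left_perp].
Qed.

(** A [coresolved] cone lies in [V], and by [coresolved_conflation] it can also be compared with an
    object of [M]. *)
Let approx X := exists Y K (f : {linear X -> Y}) (g : {linear Y -> K}),
  [/\ conflation f g, H Y & coresolved K].

Let approx_H X : H X -> approx X.
Proof.
move=> HX; have [Z Z0] := zero_module_exists R; have [_ Mproj _] := silting_M.
exists X, Z, (lid X), (lzero X Z); split=> //.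
  exact: conflation_ext (id_exact X Z0).2 (Hgp HX) (gp_zero Z0).
exact/coresolved_base/Mproj/projective0.
Qed.

Let approx_cocone A B K (f : {linear A -> B}) (g : {linear B -> K}) :
  conflation f g -> coresolved K -> approx B -> approx A.
Proof.
move=> [gA gB gK s] cK [Y [L [u [w [[_ gY gL t] HY cL]]]]].
have [N [q [i [p [s' t']]]]] := exact_comp_mono s t.
have cN := conflation_ext t' gK gL; have [_ gN _ _] := cN.
exists Y, N, (lcomp u f), q; split=> //.
exact: coresolved_ext cN cK cL.
Qed.

(** A pushout along the approximation of [A], then [conflation_along] applied to that of [C], map
    [B] in two steps with coresolved cones to an extension of [YC] by [YA]. *)
Let approx_ext A B C (f : {linear A -> B}) (g : {linear B -> C}) :
  conflation f g -> approx A -> approx C -> approx B.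
Proof.
move=> [gA gB gC s] [YA [KA [a [a' [[_ gYA gKA ea] HYA cKA]]]]].
move=> [YC [KC [c [c' [conf HYC cKC]]]]]; have [_ Hext _] := extH.
have [E [f' [g' [u [w [s' t]]]]]] := pushout_exact s ea.
have ext2 : E1 KC (susp YA).
  by apply: (VE1 (i := 1%N)) => //; apply: coresolved_left_perp.
have [F [f1 [g1 [u1 [w1 [c1 c2]]]]]] :=
  conflation_along (conflation_ext s' gYA gC) conf ext2.
apply: (approx_cocone (conflation_ext t gB gKA) cKA).
by exists F, KC, u1, w1; split=> //; apply: Hext c1 HYA HYC.
Qed.

Let approx_ext_class : ext_class approx.
Proof.
have [Hproj _ _] := extH; have [_ Mproj _] := silting_M.
split=> [P projP|A B C f g|X P gX projP]; first exact/approx_H/Hproj.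
  exact: approx_ext.
apply: (approx_cocone (split_conflation gX (gp_projective projP))).
exact/coresolved_base/Mproj.
Qed.

(** The quotient of [Y] by [Z] contains [X] with cokernel [K], and by rotation it is built from [Y]
    and Z[1]. *)
Let approx_summand X Z : gp X -> gp Z ->
  approx (X * Z)%type -> approx (susp Z) -> approx X.
Proof.
move=> gX gZ [Y [K [u [w [[gXZ gY gK t] HY cK]]]]] aZ.
have [Y' [q [i [p [s' t']]]]] := exact_comp_mono (split_exact_l X Z) t.
have conf := conflation_ext t' gX gK; have [_ gY' _ _] := conf.
apply: approx_cocone conf cK _.
apply: (ext_class_cone approx_ext_class (conflation_ext s' gZ gY')) aZ.
  exact: shift_susp.
exact: approx_H.
Qed.

(** All shifts are required so that the class is shift-stable, and one shift in [H] so that the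
    induction for summands can start. *)
Let W X := [/\ gp X, forall n, approx (iter n susp X),
  forall n, approx (iter n loop X) & exists n, H (iter n susp X)].

Let W_ext_class : ext_class W.
Proof.
have -> : W = fun X => gp X /\ ((forall n, True -> approx (iter n susp X)) /\
    ((forall n, True -> approx (iter n loop X)) /\
      exists n, H (iter n susp X))).
  apply/funext => X; apply/propext; split=> [[gX aX bX hX]|[gX [aX [bX hX]]]].
    by [].
  by split=> // n; [exact: aX|exact: bX].
have aE := approx_ext_class.
apply: ext_class_and; first exact: ext_class_gp.
apply: ext_class_and.
  by apply: ext_class_all => n _; apply: ext_class_iter_susp.
apply: ext_class_and.
  by apply: ext_class_all => n _; apply: ext_class_iter_loop.
by apply: ext_class_union => n; [exact: ext_class_iter_susp|move=> X _ /H_susp].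
Qed.

Let W_susp X : gp X -> W X <-> W (susp X).
Proof.
move=> gX; have aE := approx_ext_class.
split=> -[_ aX bX [m hX]]; split=> //.
- exact: gp_susp.
- by move=> n; rewrite -iterSr.
- case=> [|n]; first exact: aX 1%N.
  by apply/(iter_loop_susp n aE).
- by exists m; rewrite -iterSr; apply: H_susp.
- case=> [|n]; last by rewrite iterSr.
  exact/(iter_loop_susp 0%N aE).
- by move=> n; apply/(iter_loop_susp n aE).
- by exists m.+1; rewrite iterSr.
Qed.

Let W_loop X : gp X -> W X <-> W (loop X).
Proof.
move=> gX; rewrite (W_susp (gp_loop gX)); have aE := W_ext_class.
exact: (iter_susp_loop 0%N aE gX).
Qed.

Let W_prod_susp X Z : gp X -> gp Z ->
  W (X * Z)%type -> W (susp X * susp Z)%type.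
Proof.
move=> gX gZ /(W_susp (gp_prod gX gZ)); have gXZ := gp_prod gX gZ.
apply: (shift_unique W_ext_class (shift_susp gXZ)).
exact: shift_prod (shift_susp gX) (shift_susp gZ).
Qed.

Let W_prod_loop X Z : gp X -> gp Z ->
  W (X * Z)%type -> W (loop X * loop Z)%type.
Proof.
move=> gX gZ /(W_loop (gp_prod gX gZ)); have gXZ := gp_prod gX gZ.
apply: (loop_unique W_ext_class (shift_loop gXZ)).
exact: shift_prod (shift_loop gX) (shift_loop gZ).
Qed.

(* Descending induction on the shift: X[n] lies in H for large n, and a summand
   X of X * Z in W inherits an approximation from one of Z[1]. *)
Let W_summand_approx n X Z : gp X -> gp Z ->
  W (X * Z)%type -> H (iter n susp (X * Z)%type) -> approx X.
Proof.
elim: n X Z => [|n IHn] X Z gX gZ WXZ HXZ; first exact/approx_H/(sumH gX gZ).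
have gXZ := gp_prod gX gZ; have [_ aXZ _ _] := WXZ.
apply: (approx_summand gX gZ (aXZ 0%N)).
have [gX1 gZ1] := (gp_susp gX, gp_susp gZ).
(* The summands trade places: now the complement Z[1] needs an approximation, and the product is one
   shift closer to [H]. *)
apply: (IHn (susp Z) (susp X)) => //.
  by apply: (ext_class_swap W_ext_class) => //; apply: W_prod_susp.
have extHn := ext_class_iter_susp n extH.
apply: (ext_class_swap extHn gX1 gZ1); move: HXZ; rewrite iterSr.
apply: (shift_unique extHn (shift_susp gXZ)).
exact: shift_prod (shift_susp gX) (shift_susp gZ).
Qed.

Let W_has_summands : has_summands W.
Proof.
have dec X Z : gp X -> gp Z -> W (X * Z)%type -> approx X.
  move=> gX gZ WXZ; have [_ _ _ [n HXZ]] := WXZ.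
  exact: W_summand_approx gX gZ WXZ HXZ.
move=> X Z gX gZ WXZ; split=> // [n|n|].
- apply: (dec _ (iter n susp Z)); [exact: gp_iter_susp..|].
  elim: n => //= n IHn; apply: W_prod_susp IHn; exact: gp_iter_susp.
- apply: (dec _ (iter n loop Z)); [exact: gp_iter_loop..|].
  elim: n => //= n IHn; apply: W_prod_loop IHn; exact: gp_iter_loop.
- have [_ _ _ [n HXZ]] := WXZ; exists n.
  exact: (has_summands_iter_susp extH sumH gX gZ HXZ).
Qed.

(** [W] is thick and contains [M]: for X in M and n >= 0, X[n] lies in [H], and X[-n-1] embeds in a
    projective with coresolved cokernel X[-n]. *)
Lemma silting_approx X : gp X -> W X.
Proof.
move: X; apply: silting_thick => [|X MX].
  by apply: (ext_class_thick W_ext_class W_has_summands) => // Y [].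
have gX := Mgp MX; split=> // [n|n|]; last by exists 0%N; apply: MH.
  exact/approx_H/H_iter_susp/MH.
case: n => [|n]; first exact/approx_H/MH.
have cX : coresolved (iter n loop X).
  elim: n => [|n IHn] /=; first exact: coresolved_base.
  exact: coresolved_loop (shift_loop (gp_iter_loop n gX)) IHn.
have [P [f [g [projP conf]]]] := shift_loop (gp_iter_loop n gX).
apply: (approx_cocone conf cX); have [Hproj _ _] := extH.
exact/approx_H/Hproj.
Qed.

(** [V] is closed under [loop], so the classes increase with [n] and their union is thick; this
    yields the bound on Ext degrees. *)
Lemma silting_bounded X : gp X -> exists n, V (iter n loop X).
Proof.
move=> gX; suff [] : gp X /\ exists n, V (iter n loop X) by [].
move: X gX; apply: silting_thick => [|X MX]; last first.
  by split; [exact: Mgp|exists 0%N; apply: MV].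
apply: ext_class_thick => [||X []|X gX] //.
- apply: ext_class_and; first exact: ext_class_gp.
  apply: ext_class_union => n; first exact: ext_class_iter_loop.
  by move=> X _ /V_loop.
- apply: has_summands_and => //; apply: has_summands_union => n.
  exact: has_summands_iter_loop.
- split=> -[_ [n VX]]; split=> //; first exact: gp_susp.
    by exists n.+1; apply/(iter_loop_susp n extV).
  by exists n; apply/(iter_loop_susp n extV) => //; apply: V_loop.
Qed.

Lemma right_perp_coresolving : coresolving_class H.
Proof.
have [Hproj Hext _] := extH; split.
- exact: subcategory_mod_iso.
- move=> C /silting_approx[_ aC _ _].
  have [X [K [f [g [conf HX cK]]]]] := aC 0%N.
  have VK := coresolved_left_perp cK.
  exists X, K, f, g; split=> // Y HY; apply/Ext_zeroP; [exact: Vgp|exact: Hgp|].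
  exact: VE1.
- split=> // A B C f g conf HA HB; have [gA _ _ _] := conf.
  exact: ext_class_cone extH conf (shift_susp gA) HB (H_susp HA).
- move=> C; split=> [[]//|gC]; split=> //.
  (* The finite coresolution runs through projectives, C[i] -> P_i -> C[i+1], and stops at a shift
     C[n] in [H], which serves as both the last kernel and the last term. *)
  have [_ _ _ [n HC]] := silting_approx gC.
  have step i : {P : lmodType R & {f : {linear iter i susp C -> P} &
      {g : {linear P -> iter i.+1 susp C} | projective P /\ conflation f g}}}.
    have /cid[P /cid[f /cid[g h]]] := shift_susp (gp_iter_susp i gC).
    by exists P, f, g.
  exists n, (fun i => iter i susp C),
    (fun i => if (i < n)%N then tag (step i) else iter n susp C); split.
  + exact: mod_iso_refl.
  + by rewrite ltnn; apply: mod_iso_refl.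
  + by move=> i _; case: ifP => // _; case: (step i) => /= P [f [g [/Hproj]]].
  + by move=> i ->; case: (step i) => /= P [f [g [_ conf]]]; exists f, g.
- move=> X HX; have gX := Hgp HX; have [n VX] := silting_bounded gX.
  exists n.+1 => // -[//|i] ni Y HY; have gY := Hgp HY; apply/Ext_zeroP => //.
  (* Ext^{i+1}(X, Y) is read as Ext^1(X[-n], Y[i-n]), where X[-n] lies in [V]. *)
  rewrite -(subnKC (m := n) (n := i)) // iterD.
  by apply/(E1_loop n gX); [exact: gp_iter_susp|exact: VE1].
Qed.

Lemma coheart_right_perp X : coheart H X <-> M X.
Proof.
split=> [[HX VX]|MX]; last by split; [exact: MH|exact: MV].
have gX := Hgp HX; have [extM sumM] := silting_ext_class.
have [_ _ bX _] := silting_approx gX.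
have [Y [K [u [w [[_ gY gK t] HY cK]]]]] := bX 1%N.
have [P [a [b [projP [_ gP _ s]]]]] := shift_loop gX.
(* [E] is an extension of [X] by [Y], split because [X] is in [V] and [Y] in [H], and it is also [P]
   plus [K]. Hence [X] is a retract of [P * K]. *)
have [E [f [g [u' [w' [s' t']]]]]] := pushout_exact s t.
have [q qE] := E1_section (VE1 (i := 0%N) VX HY) s'.
have [i [j [ij ji]]] := E1_iso (gp_E1 gK projP) t'.
have [M0 [K' [f1 [g1 [[_ gM0 gK' s1] MM0 VK']]]]] := coresolved_conflation cK.
have [Z Z0] := zero_module_exists R.
have VZK : V (Z * K')%type.
  by have [Vproj _ _] := extV; apply: ext_class_prod => //; [exact: gp_zero|
    exact/Vproj/projective0].
(* The map from [P * K] to [X] extends to [P * M0], since the cokernel is in [V] and [X] in [H]; so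
   [X] is a retract of an object of [M]. *)
have [r rE] :=
  VE1 (i := 0%N) VZK HX (exact_prod (id_exact P Z0).2 s1) (lcomp g i).
have [Mproj _ _] := extM.
pose v := lpair (lcomp (lid P) (lfst P K)) (lcomp f1 (lsnd P K)).
have rv x : r (lcomp v (lcomp j q) x) = x by rewrite rE /= ji qE.
apply: (ext_class_retract extM sumM _ gX rv); first exact: gp_prod.
by apply: ext_class_prod => //; apply: Mproj.
Qed.

End SiltingToCoresolving.

(** * From coresolving to silting subcategories *)

Section CoresolvingToSilting.
Variable R : pzRingType.
Implicit Types (A B C E K L P Q X Y Z : lmodType R).
Notation gp := (@gorenstein_projective R).
Variable H : lmodType R -> Prop.
Hypothesis coresolving_H : coresolving_class H.

Let M := coheart H.
Let V := left_perp H.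

Let Hgp X : H X -> gp X.
Proof. by case: coresolving_H => -[[+ _ _ _] _] _ _ _ _; apply. Qed.

Let sumH : has_summands H.
Proof.
case: coresolving_H => -[_ Hsum] _ _ _ _ X Z gX gZ.
exact: (Hsum X _ Z gX gZ (mod_iso_refl _)).
Qed.

Let extH : ext_class H.
Proof.
case: coresolving_H => _ _ [Hproj Hext _] _ _; split=> // X P gX projP.
exact/sumH/gp_projective.
Qed.

Let H_susp X : H X -> H (susp X).
Proof.
move=> HX; case: coresolving_H => _ _ [Hproj _ Hcone] _ _.
have [P [f [g [projP conf]]]] := shift_susp (Hgp HX).
by apply: Hcone conf HX _; apply: Hproj.
Qed.

Let H_iter_susp n X : H X -> H (iter n susp X).
Proof. by move=> HX; elim: n => //= n; apply: H_susp. Qed.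

Let extV : ext_class V := (left_perp_ext_class Hgp).1.
Let sumV : has_summands V := (left_perp_ext_class Hgp).2.

Let VE1 X Y i : V X -> H Y -> E1 X (iter i susp Y).
Proof. by move=> /(left_perpP _ Hgp)[_ VX] HY; apply: VX. Qed.

(** [H] is closed under suspension, so vanishing of Ext^1 against [H] gives vanishing in all
    positive degrees. *)
Let approximation C : gp C -> exists X K (f : {linear C -> X})
  (g : {linear X -> K}), [/\ conflation f g, H X & V K].
Proof.
case: coresolving_H => _ Hcov _ _ _ /Hcov[X [K [f [g [conf HX perp]]]]].
have [gC gX gK s] := conf.
exists X, K, f, g; split=> //; apply/left_perpP => //; split=> // Y HY i.
have HiY := H_iter_susp i HY; apply/(Ext_zeroP 0%N) => //; last exact: perp.
exact: Hgp.
Qed.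

Let extM : ext_class M.
Proof. exact: ext_class_and. Qed.

Let sumM : has_summands M.
Proof. exact: has_summands_and. Qed.

Let Mgp X : M X -> gp X.
Proof. by case=> /Hgp. Qed.

(** Descent along the finite coresolution: K_i is built from H_{-i} and K_{i+1}[-1], starting from
    K_n in [H]. *)
Let check_induction (D : lmodType R -> Prop) : ext_class D ->
  (forall X, H X -> D X) -> (forall X, gp X -> D X -> D (loop X)) ->
  forall X, gp X -> D X.
Proof.
move=> extD HD D_loop X gX; case: coresolving_H => _ _ _ Hcheck _.
have [_ [n [K [L [iso0 ison HL conf]]]]] := (Hcheck X).2 gX.
suff DK m : (m <= n)%N -> gp (K (n - m)%N) /\ D (K (n - m)%N).
  by have [] := DK n (leqnn n); rewrite subnn => gK; apply: ext_class_iso.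
elim: m => [_|m IHm mn].
  rewrite subn0; have gL := Hgp (HL n (leqnn n)).
  have iso := mod_iso_sym ison; split; first exact: gp_iso iso gL.
  exact: ext_class_iso extD gL iso (HD _ (HL n (leqnn n))).
have [gK DK] := IHm (ltnW mn); have i_n : (n - m.+1 < n)%N.
  by rewrite ltn_subrL (leq_trans _ mn).
have := conf _ i_n; rewrite subnSK // => -[f [g c]]; have [gKi _ _ _] := c.
split=> //; apply: ext_class_cocone extD c (shift_loop gK) _ (D_loop _ gK DK).
exact/HD/HL/ltnW.
Qed.

Lemma coheart_thick S : thick_subcat S -> (forall X, M X -> S X) ->
  forall X, gp X -> S X.
Proof.
move=> thickS MS; have [extS sumS S_susp] := thick_ext_class thickS.
apply: check_induction => [//|X HX|]; last exact: thick_loop.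
(* Here [t] bounds the shift, one less than the Ext degree, so [t = 0] puts [X] in the coheart. *)
have [t tE] : exists t, forall i, (t <= i)%N -> forall Y, H Y ->
    E1 X (iter i susp Y).
  case: coresolving_H => _ _ _ _ /(_ X HX)[t _ tE]; exists t => i ti Y HY.
  by apply/Ext_zeroP; [exact: Hgp..|apply: tE => //; apply: leqW].
elim: t X HX tE => [|t IHt] X HX tE.
  apply: MS; split=> //; apply/left_perpP => //; split; first exact: Hgp.
  by move=> Y HY i; apply: tE.
have gX := Hgp HX; have [P [a [b [projP [gL gP _ s]]]]] := shift_loop gX.
have [Y [K [u [w [[_ gY gK t'] HY VK]]]]] := approximation gL.
(* [E] is an extension of [X] by [Y], hence in [H], and of [K] by [P], hence in [V]. *)
have [E [f [g [u' [w' [s1 t1]]]]]] := pushout_exact s t'.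
have c1 := conflation_ext s1 gY gX; have c2 := conflation_ext t1 gP gK.
have [[_ Hext _] [Vproj Vext _]] := (extH, extV).
have ME : M E.
  by split; [exact: Hext c1 HY HX|exact: Vext c2 (Vproj _ projP) VK].
have SY : S Y.
  (* Ext^{i+1}(Y, Z) lies between Ext^{i+1}(E, Z) and Ext^{i+2}(X, Z), so the bound drops by one. *)
  apply: IHt => // i ti Z HZ.
  apply: (ext_class_cocone (ext_class_E1l _) c1 (shift_loop gX)).
    by apply: VE1 => //; case: ME.
  by apply/E1_susp_gp; [|exact: Hgp|exact: tE].
exact: ext_class_cone extS c1 (shift_susp gY) (MS _ ME) (S_susp _ gY SY).
Qed.

Lemma coheart_silting : silting_class M.
Proof.
split; first exact: subcategory_mod_iso.
  by case: extM.
split; first exact: subcategory_stable_iso.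
- move=> X Y Y' [//|i] _ [HX VX] [HY VY] sY.
  (* Any representative of Y[i+1] is a shift of some Y[i] in [H], which turns the stable Hom into
     Ext^1. *)
  have [Z HZ sZ] : exists2 Z, H Z & shift Z Y'.
    elim: i Y HY {VY} sY => [|i IHi] Y HY /= [Z sYZ].
      by move=> <-; exists Y.
    apply: IHi; exact: shift_unique extH (shift_susp (Hgp HY)) sYZ (H_susp HY).
  apply/(stably_zeroP (Hgp HX) sZ); exact: (VE1 (i := 0%N) VX HZ).
- move=> X; split=> [[]//|gX]; split=> // S thickS MS.
  exact: coheart_thick.
Qed.

(** Objects of [H] have [n = 0], and passing to X[-1] raises [n] by one. *)
Lemma coresolving_bounded X : gp X -> exists n, H (iter n susp X).
Proof.
move: X; apply: check_induction => [|X HX|X gX [n HX]].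
- apply: ext_class_union => [n|n X _ /H_susp //].
  exact: ext_class_iter_susp.
- by exists 0%N.
- by exists n.+1; apply/(iter_susp_loop n extH).
Qed.

(* Induction on n such that X[n] lies in H: an approximation X -> M0 -> X1 has
   M0 in the coheart and X1[n - 1] in H. *)
Lemma left_perp_right_perp_coheart X Y i :
  V X -> right_perp M Y -> E1 X (iter i susp Y).
Proof.
move=> VX pY; have /(right_perpP _ Mgp)[gY MY] := pY.
have gX : gp X by case: VX.
have [n HX] := coresolving_bounded gX.
elim: n X VX gX HX i => [|n IHn] X VX gX HX i; first by apply: MY; split.
have [X0 [X1 [f [g [c HX0 VX1]]]]] := approximation gX.
have [_ _ gX1 _] := c; have [_ Vext _] := extV.
have VX0 : V X0 by apply: Vext c VX VX1.
(* Ext^{i+1}(X, Y) lies between Ext^{i+1}(X0, Y) and Ext^{i+2}(X1, Y); the induction hypothesis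
   handles the latter. *)
apply: (ext_class_cocone (ext_class_E1l _) c (shift_loop gX1)).
  by apply: MY; split.
apply/E1_susp_gp => //; apply: IHn => //.
apply: (ext_class_cone (ext_class_iter_susp n extH) c (shift_susp gX)).
  exact: H_iter_susp.
by move: HX; rewrite iterSr.
Qed.

(** For [X] orthogonal to the coheart, Ext^1(K, X) = 0 splits the approximation X -> Y -> K, so [X]
    is a summand of [Y]. *)
Lemma right_perp_coheart X : right_perp M X <-> H X.
Proof.
split=> [pX|HX]; last first.
  apply/right_perpP => //; split=> [|Y [_ VY] i]; first exact: Hgp.
  exact: VE1.
have gX : gp X by case: pX.
have [Y [K [f [g [[_ gY gK s] HY VK]]]]] := approximation gX.
have iso := E1_iso (left_perp_right_perp_coheart (i := 0%N) VK pX) s.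
apply: (sumH gX gK); exact: ext_class_iso extH gY (mod_iso_sym iso) HY.
Qed.

End CoresolvingToSilting.

Theorem corollary4p19 (R : pzRingType) :
  (forall M : lmodType R -> Prop,
     silting_class M -> coresolving_class (right_perp M)) /\
  (forall H : lmodType R -> Prop,
     coresolving_class H -> silting_class (coheart H)) /\
  (forall M : lmodType R -> Prop, silting_class M ->
     forall X : lmodType R, coheart (right_perp M) X <-> M X) /\
  (forall H : lmodType R -> Prop, coresolving_class H ->
     forall X : lmodType R, right_perp (coheart H) X <-> H X).
Proof.
split; first exact: right_perp_coresolving.
split; first exact: coheart_silting.
split; first exact: coheart_right_perp.
exact: right_perp_coheart.
Qed.
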